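(* Let $d\ge2$ be an integer and let $Y\subseteq\mathbb{C}[\mathbb{F}_d]$ be any finite dimensional subspace. For $p\in[2,\infty]$ let $Y_p$ be $Y$ equipped with the operator space structure inherited from $C^*_{\ell^p}(\mathbb{F}_d)$. Then for every $p\in[2,\infty]$, $$\lim_{q\to p}d_{cb}(Y_q,Y_p)=1,$$ where $q$ ranges over $[2,\infty]$.
   Context: $\mathbb{F}_d$ is the free group of rank $d$. $\ell^p$-completions: for a discrete group $\Gamma$ and $2\le p\le\infty$, a unitary representation $(\pi,H)$ of $\Gamma$ is an $\ell^p$-representation if there is a dense subspace $K\subseteq H$ such that for all $\xi,\eta\in K$ the matrix coefficient $t\mapsto\langle\pi(t)\xi,\eta\rangle$ lies in $\ell^p(\Gamma)$. For $x\in\mathbb{C}[\Gamma]$ put $$\Vert x\Vert_{C^*_{\ell^p}(\Gamma)}=\sup\{\Vert\pi(x)\Vert:\pi\text{ is an }\ell^p\text{-representation of }\Gamma\},$$ and let $C^*_{\ell^p}(\Gamma)$ be the completion of $\mathbb{C}[\Gamma]$ in this norm. Completely bounded Banach–Mazur distance: for operator spaces $X,Y$, $$d_{cb}(X,Y)=\inf\{\Vert\phi\Vert_{cb}\Vert\phi^{-1}\Vert_{cb}:\phi:X\to Y\text{ is a linear isomorphism}\}.$$ *)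

(* Defs.v *)
From HB Require Import structures.
From mathcomp Require Import all_boot all_order all_algebra.
From mathcomp Require Import sesquilinear complex finmap.
From mathcomp.multinomials Require monalg.
Import -(notations) monalg.
From mathcomp Require Import all_classical all_reals all_analysis.

Set Implicit Arguments.
Unset Strict Implicit.
Unset Printing Implicit Defensive.

Import Order.TTheory GRing.Theory Num.Theory.
Import numFieldNormedType.Exports.

Local Open Scope classical_set_scope.
Local Open Scope ring_scope.

Section FreeGroup.
Context (d : nat).

(* (i, false) stands for the i-th generator, (i, true) for its inverse. *)
Definition letter : Type := ('I_d * bool)%type.
Definition letter_inv (a : letter) : letter := (a.1, ~~ a.2).
Definition reduced (w : seq letter) : bool :=
  sorted (fun a b => b != letter_inv a) w.

Record free_group := FreeGroup { word :> seq letter; _ : reduced word }.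

HB.instance Definition _ := [isSub for word].
HB.instance Definition _ := [Countable of free_group by <:].

(* Left multiplication of a reduced word by a letter. *)
Definition push (a : letter) (w : seq letter) : seq letter :=
  if w is b :: w' then if b == letter_inv a then w' else a :: w else [:: a].

Lemma letter_invK : involutive letter_inv.
Proof. by case=> i b; rewrite /letter_inv negbK. Qed.

Lemma reduced_push a w : reduced w -> reduced (push a w).
Proof.
case: w => [//|b w] rw; rewrite /push; case: ifP => [_|/negbT h].
  exact: (path_sorted rw).
by rewrite /reduced /= h.
Qed.

Lemma pushK a w : reduced w -> push (letter_inv a) (push a w) = w.
Proof.
case: w => [_|b w rw]; first by rewrite /= letter_invK eqxx.
rewrite [push a _]/push; case: (b =P letter_inv a) => [ba|_].
  rewrite -ba; case: w rw => [//|c w] /= /andP[/negbTE h _].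
  by rewrite h.
by rewrite /= letter_invK eqxx.
Qed.

Lemma reduced_foldr v w : reduced w -> reduced (foldr push w v).
Proof. by move=> rw; elim: v => //= a v; apply: reduced_push. Qed.

Lemma foldr_push a v w : reduced w -> reduced v ->
  foldr push w (push a v) = push a (foldr push w v).
Proof.
case: v => [//|b v] rw rv; rewrite [push a _]/push.
case: (b =P letter_inv a) => [-> /=|//].
by rewrite -{1}[a]letter_invK pushK// reduced_foldr.
Qed.

Lemma foldr_pushA u v w : reduced v -> reduced w ->
  foldr push w (foldr push v u) = foldr push (foldr push w v) u.
Proof.
move=> rv rw; elim: u => //= a u <-.
by rewrite foldr_push// reduced_foldr.
Qed.

Lemma foldr_push_reduced w : reduced w -> foldr push [::] w = w.
Proof.
elim: w => //= a w IHw raw; rewrite IHw; last exact: path_sorted raw.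
by case: w raw {IHw} => //= b w /andP[/negbTE ->].
Qed.

Lemma reduced_inv w : reduced w -> reduced (rev (map letter_inv w)).
Proof.
rewrite /reduced rev_sorted sorted_map; apply: sub_sorted => a b /=.
by apply: contra => /eqP->; rewrite letter_invK.
Qed.

Lemma foldr_pushK w t : reduced t ->
  foldr push (foldr push t w) (rev (map letter_inv w)) = t.
Proof.
move=> rt; elim: w => //= a w IHw.
by rewrite rev_cons foldr_rcons pushK ?reduced_foldr.
Qed.

Lemma foldr_push_inv w : reduced w ->
  foldr push w (rev (map letter_inv w)) = [::].
Proof.
by move=> rw; rewrite -{1}(foldr_push_reduced rw) foldr_pushK.
Qed.

Lemma word_reduced (g : free_group) : reduced g.
Proof. by case: g. Qed.

Definition fg_one : free_group := @FreeGroup [::] isT.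
Definition fg_mul (g h : free_group) : free_group :=
  FreeGroup (reduced_foldr g (word_reduced h)).
Definition fg_inv (g : free_group) : free_group :=
  FreeGroup (reduced_inv (word_reduced g)).

Lemma fg_mulA : associative fg_mul.
Proof.
move=> g h k; apply: val_inj; rewrite /= foldr_pushA//; exact: word_reduced.
Qed.

Lemma fg_mul1g : left_id fg_one fg_mul.
Proof. by move=> g; apply: val_inj. Qed.

Lemma fg_mulg1 : right_id fg_one fg_mul.
Proof.
by move=> g; apply: val_inj; rewrite /= foldr_push_reduced// word_reduced.
Qed.

Lemma fg_mulVg : left_inverse fg_one fg_inv fg_mul.
Proof.
by move=> g; apply: val_inj; rewrite /= foldr_push_inv// word_reduced.
Qed.

Lemma fg_mulgV : right_inverse fg_one fg_inv fg_mul.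
Proof.
move=> g; rewrite -{1}[g]fg_mul1g -{1}(fg_mulVg (fg_inv g)) -!fg_mulA.
by rewrite (fg_mulA _ g) fg_mulVg fg_mul1g fg_mulVg.
Qed.

HB.instance Definition _ :=
  isGroup.Build free_group fg_mulA fg_mul1g fg_mulg1 fg_mulVg fg_mulgV.

End FreeGroup.

(* The norm of a normed space over R[i] is valued in the nonnegative reals of
   R[i]; this is the same norm valued in R. *)
Notation rnorm x := (complex.Re `|x|).

(* Inner products are linear in the first variable. *)
Record hilbertSpace (R : realType) := HilbertSpace {
  hilbert_sort :> completeNormedModType R[i] ;
  dot : {dot hilbert_sort for (@Num.Def.conjC R[i])} ;
  _ : forall x : hilbert_sort, `|x| ^+ 2 = dot x x
}.

Notation group_algebra R G := (malg G R[i]).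

Section Representations.
Context (R : realType) (G : groupType).

(* Each [urep g] is isometric, and onto because it has inverse [urep g^-1]. *)
Record unitary_rep (H : hilbertSpace R) := UnitaryRep {
  urep :> G -> {linear H -> H} ;
  _ : forall x, urep 1%g x = x ;
  _ : forall g h x, urep (g * h)%g x = urep g (urep h x) ;
  _ : forall g x y, dot H (urep g x) (urep g y) = dot H x y
}.

Definition in_lp (p : \bar R) (f : G -> R[i]) : Prop :=
  match p with
  | r%:E => (\esum_(g in [set: G]) (rnorm (f g) `^ r)%:E < +oo)%E
  | +oo%E => exists M : R, forall g, rnorm (f g) <= M
  | -oo%E => False
  end.

Definition is_subspace (V : lmodType R[i]) (X : set V) : Prop :=
  X 0 /\ forall (a : R[i]) x y, X x -> X y -> X (a *: x + y).

Definition finite_dimensional (V : lmodType R[i]) (X : set V) : Prop :=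
  exists (n : nat) (b : 'I_n -> V),
    X = [set x | exists c : 'I_n -> R[i], x = \sum_i c i *: b i].

Definition lp_rep (p : \bar R) (H : hilbertSpace R) (u : unitary_rep H) : Prop :=
  exists K : set H, [/\ is_subspace K, dense K &
    forall x y, K x -> K y -> in_lp p (fun g => dot H (u g x) y)].

Definition alg_rep (H : hilbertSpace R) (u : unitary_rep H)
    (a : group_algebra R G) (x : H) : H :=
  \sum_(g <- msupp a) mcoeff g a *: u g x.

Definition vnorm (H : hilbertSpace R) n (x : 'I_n -> H) : R :=
  Num.sqrt (\sum_i rnorm (x i) ^+ 2).

Definition amp_rep (H : hilbertSpace R) (u : unitary_rep H) n
    (A : 'M[group_algebra R G]_n) (x : 'I_n -> H) : 'I_n -> H :=
  fun i => \sum_j alg_rep u (A i j) (x j).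

Definition amp_norm (H : hilbertSpace R) (u : unitary_rep H) n
    (A : 'M[group_algebra R G]_n) : \bar R :=
  ereal_sup [set (vnorm (amp_rep u A x))%:E | x in [set x | vnorm x <= 1]].

(* The norm of M_n of the l^p-completion of C[G], restricted to M_n(C[G]).  The
   direct sum of (a representative set of) all l^p-representations is, by
   definition of the completion, isometric on it; this is the operator space
   structure read off from that faithful representation.  For n = 1 it is the
   norm whose completion is taken. *)
Definition lp_mxnorm (p : \bar R) n (A : 'M[group_algebra R G]_n) : \bar R :=
  ereal_sup [set r | exists (H : hilbertSpace R) (u : unitary_rep H),
    lp_rep p u /\ r = amp_norm u A].

End Representations.

Section BanachMazur.
Context (R : realType).

(* A family of norms on the matrix spaces over V; a subspace of V with the
   restricted norms is an operator space. *)
Definition mxnorms (V : lmodType R[i]) := forall n, 'M[V]_n -> \bar R.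

Definition cb_norm (V W : lmodType R[i]) (NV : mxnorms V) (NW : mxnorms W)
    (X : set V) (phi : V -> W) : \bar R :=
  ereal_sup [set r | exists n (A : 'M[V]_n),
    [/\ forall i j, X (A i j), (NV n A <= 1)%E & r = NW n (map_mx phi A)]].

(* Values of phi outside X and of psi outside Y are irrelevant. *)
Definition linear_iso (V W : lmodType R[i]) (X : set V) (Y : set W)
    (phi : V -> W) (psi : W -> V) : Prop :=
  [/\ forall (a : R[i]) x y, X x -> X y -> phi (a *: x + y) = a *: phi x + phi y,
      forall x, X x -> Y (phi x), forall y, Y y -> X (psi y),
      forall x, X x -> psi (phi x) = x & forall y, Y y -> phi (psi y) = y].

Definition d_cb (V W : lmodType R[i]) (NV : mxnorms V) (NW : mxnorms W)
    (X : set V) (Y : set W) : \bar R :=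
  ereal_inf [set r | exists (phi : V -> W) (psi : W -> V),
    linear_iso X Y phi psi /\
    r = (cb_norm NV NW X phi * cb_norm NW NV Y psi)%E].

End BanachMazur.

(* Main.v *)
Require Import Defs.
From HB Require Import structures.
From mathcomp Require Import all_boot all_order all_algebra.
From mathcomp Require Import sesquilinear complex finmap.
From mathcomp.multinomials Require monalg.
Import -(notations) monalg.
From mathcomp Require Import all_classical all_reals all_analysis.
From mathcomp Require Import ring lra.

Import Order.TTheory GRing.Theory Num.Theory.
Import numFieldNormedType.Exports.
Local Open Scope classical_set_scope.
Local Open Scope ring_scope.

Set Implicit Arguments.
Unset Strict Implicit.
Unset Printing Implicit Defensive.

(** Let |g| be word length in the free group G of rank d, and let N_p be the
    matrix norms coming from all l^p-representations.

    If p <= q, an l^p-representation is an l^q-representation, so N_p <= N_q and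
    the identity from Y_q to Y_p is completely contractive.  What has to be shown
    is that the inverse identity has cb-norm at most 1 + o(1), where q may be the
    smaller or the larger of the two exponents.

    Haagerup's function r^|g|, 0 < r < 1, is positive definite, and multiplying
    the coefficients of an l^q-representation u by it makes them l^p: by Hoelder
    it is enough that r^|g| lies in l^s with 1/s = 1/p - 1/q.  As there are at
    most (2d)^n words of length n, this holds as soon as 2d r^s < 1, and s tends
    to infinity when q tends to p; so r can be taken as close to 1 as desired
    ([summ_growth], [in_lp_transfer]).

    Positive definiteness is used through an explicit representation.  On the
    Hilbert space of square summable functions from G to H, the representation
    [haagerup u] is the tensor product of u with a perturbation of the regular
    representation: a generator acts by translation, followed by a rotation in
    the plane of the two vertices of the Cayley tree that it exchanges with
    respect to distance from the origin.  Since G is free, prescribing isometries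
    for the letters, inverse letters going to inverse isometries, is enough.
    The image of the point mass at 1 under g is an explicit vector on the
    geodesic from 1 to g ([haagerup_single]), whose value at 1 is r^|g|.  This
    gives N_q(M_r x) <= N_p(x) where M_r multiplies the coefficient of g by
    r^|g|, once [haagerup u] is known to be an l^p-representation
    ([haagerup_lp]).

    If the support of x lies in a finite set S, the remainder x - M_r x is the
    sum over g in S of (1 - r^|g|) x_g g, and each matrix coefficient x_g has
    norm at most N_p(x), as seen in the regular representation, which is the
    case r = 0 of the same construction ([coef_op_le]).  Hence
    N_q(x) <= (1 + sum over S of (1 - r^|g|)) N_p(x) ([contraction_bound]),
    and d_cb(Y_q, Y_p) is bounded by the factor, which tends to 1 with r.

    The bound d_cb >= 1 is obtained by following one nonzero vector through an
    isomorphism and back ([d_cb_ge1]); it needs N_p to be finite and nonzero on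
    nonzero vectors. *)

(** * Unconditional sums *)

Section RealSums.
Context (R : realType) (I : choiceType).
Implicit Types a b : I -> R.

(** Meaningful for nonnegative summable families, where the extended real sum is
    finite; [fine] sends an infinite sum to 0. *)
Definition nsum a : R := fine (\esum_(i in [set: I]) (a i)%:E).

(** Absolute summability, as a real bound on finite partial sums, which is the
    form in which it is proved and used below. *)
Definition summ a : Prop :=
  exists M : R, forall J : {fset I}, \sum_(i <- J) `|a i| <= M.

Lemma esum_le_fset a M : (forall i, 0 <= a i) ->
  (forall J : {fset I}, \sum_(i <- J) a i <= M) ->
  (\esum_(i in [set: I]) (a i)%:E <= M%:E)%E.
Proof.
move=> a0 aM; apply: ge_ereal_sup => _ [X [finX _] <-].
by rewrite fsbig_finite//= sumEFin lee_fin aM.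
Qed.

Lemma fset_le_esum a (J : {fset I}) : (forall i, 0 <= a i) ->
  ((\sum_(i <- J) a i)%:E <= \esum_(i in [set: I]) (a i)%:E)%E.
Proof.
move=> a0; apply: ereal_sup_ubound; exists [set` J]; first by split.
by rewrite fsbig_finite//= set_fsetK sumEFin.
Qed.

Lemma summP a : summ a <-> (\esum_(i in [set: I]) `|a i|%:E < +oo)%E.
Proof.
split=> [[M aM]|h]; first by apply: le_lt_trans (ltry M); apply: esum_le_fset.
have f : \esum_(i in [set: I]) `|a i|%:E \is a fin_num.
  by rewrite ge0_fin_numE// esum_ge0// => i _; rewrite lee_fin.
exists (fine (\esum_(i in [set: I]) `|a i|%:E)) => J.
by rewrite -lee_fin fineK//; exact: (@fset_le_esum (fun i => `|a i|)).
Qed.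

Lemma summ_le a b : (forall i, `|a i| <= `|b i|) -> summ b -> summ a.
Proof. by move=> ab [M bM]; exists M => J; exact: le_trans (ler_sum _ _) (bM J). Qed.

Lemma summD a b : summ a -> summ b -> summ (fun i => a i + b i).
Proof.
move=> [M aM] [N bN]; exists (M + N) => J.
apply: le_trans (lerD (aM J) (bN J)); rewrite -big_split /=.
by apply: ler_sum => i _; exact: ler_normD.
Qed.

Lemma summZ k a : summ a -> summ (fun i => k * a i).
Proof.
move=> [M aM]; exists (`|k| * M) => J.
apply: le_trans (ler_wpM2l (normr_ge0 k) (aM J)); rewrite mulr_sumr.
by apply: ler_sum => i _; rewrite normrM.
Qed.

Lemma summN a : summ a -> summ (fun i => - a i).
Proof. by apply: summ_le => i; rewrite normrN. Qed.

Lemma nsum_EFin a : (forall i, 0 <= a i) -> summ a ->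
  (nsum a)%:E = \esum_(i in [set: I]) (a i)%:E.
Proof.
move=> a0 /summP h; rewrite fineK// ge0_fin_numE; last by apply: esum_ge0 => i _; rewrite lee_fin.
by under eq_esum => i _ do rewrite -(ger0_norm (a0 i)).
Qed.

Lemma nsum_ge a (J : {fset I}) : (forall i, 0 <= a i) -> summ a ->
  \sum_(i <- J) a i <= nsum a.
Proof. by move=> a0 sa; rewrite -lee_fin nsum_EFin//; exact: fset_le_esum. Qed.

Lemma nsum_le a M : (forall i, 0 <= a i) ->
  (forall J : {fset I}, \sum_(i <- J) a i <= M) -> nsum a <= M.
Proof.
move=> a0 aM; rewrite -lee_fin nsum_EFin//; first exact: esum_le_fset.
by exists M => J; under eq_bigr do rewrite ger0_norm//.
Qed.

Lemma nsum_ge0 a : (forall i, 0 <= a i) -> 0 <= nsum a.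
Proof. by move=> a0; apply: fine_ge0; apply: esum_ge0 => i _; rewrite lee_fin. Qed.

Lemma nsumD a b : (forall i, 0 <= a i) -> (forall i, 0 <= b i) ->
  summ a -> summ b -> nsum (fun i => a i + b i) = nsum a + nsum b.
Proof.
move=> a0 b0 sa sb; apply: EFin_inj; rewrite EFinD !nsum_EFin//.
- by under eq_esum do rewrite EFinD; rewrite esumD// => i _; rewrite lee_fin.
- by move=> i; rewrite addr_ge0.
- exact: summD.
Qed.

Lemma nsumZ k a : 0 <= k -> (forall i, 0 <= a i) -> summ a ->
  nsum (fun i => k * a i) = k * nsum a.
Proof.
have le k' a' : 0 <= k' -> (forall i, 0 <= a' i) -> summ a' ->
    nsum (fun i => k' * a' i) <= k' * nsum a'.
  move=> k0 a0 sa; apply: nsum_le => [i|J]; first by rewrite mulr_ge0.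
  by rewrite -mulr_sumr ler_wpM2l// nsum_ge.
move=> k0 a0 sa; apply/eqP; rewrite eq_le le//=.
have [->|kn0] := eqVneq k 0.
  by rewrite mul0r nsum_ge0// => i; rewrite mul0r.
rewrite -ler_pdivlMl ?lt_def ?kn0//.
have := le k^-1 (fun i => k * a i); rewrite invr_ge0 => /(_ k0).
rewrite (_ : (fun i => k^-1 * (k * a i)) = a); last first.
  by apply/funext => i; rewrite mulKf.
by apply; [move=> i; rewrite mulr_ge0|exact: summZ].
Qed.

Definition rsum a : R :=
  nsum (fun i => Num.max (a i) 0) - nsum (fun i => Num.max (- a i) 0).

Let max0 (x : R) : 0 <= Num.max x 0. Proof. by rewrite le_max lexx orbT. Qed.

Let summ_max a : summ a -> summ (fun i => Num.max (a i) 0).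
Proof.
apply: summ_le => i; rewrite ger0_norm// ge_max normr_ge0 andbT.
exact: ler_norm.
Qed.

(** The signed sum can be computed from any decomposition into nonnegative
    summable families, not only from positive and negative parts; additivity
    and homogeneity of [rsum] come from this freedom. *)
Lemma rsumB a b : (forall i, 0 <= a i) -> (forall i, 0 <= b i) ->
  summ a -> summ b -> rsum (fun i => a i - b i) = nsum a - nsum b.
Proof.
move=> a0 b0 sa sb; have sab := summD sa (summN sb).
have sba := summN sab.
apply/eqP; rewrite subr_eq addrAC eq_sym subr_eq; apply/eqP.
rewrite -!nsumD//; try exact: summ_max; congr nsum; apply/funext => i.
by rewrite /Num.max; do 2 case: ifPn; rewrite -?leNgt => *; lra.
Qed.

Lemma rsum_nsum a : (forall i, 0 <= a i) -> summ a -> rsum a = nsum a.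
Proof.
move=> a0 sa; have := @rsumB a (fun=> 0) a0 (fun=> lexx _) sa.
have -> : nsum (fun=> 0) = 0 :> R.
  by apply/eqP; rewrite eq_le nsum_ge0// nsum_le// => J; rewrite big1.
by rewrite subr0 => <-; [under [in RHS]eq_fun do rewrite subr0|exists 0 => J; rewrite big1// => i _; rewrite normr0].
Qed.

Let posneg (x : R) : x = Num.max x 0 - Num.max (- x) 0.
Proof. by rewrite /Num.max; do 2 case: ifPn; rewrite -?leNgt => *; lra. Qed.

Lemma rsumD a b : summ a -> summ b ->
  rsum (fun i => a i + b i) = rsum a + rsum b.
Proof.
move=> sa sb; have sa' := summN sa; have sb' := summN sb.
rewrite (_ : (fun i => _) = (fun i => (Num.max (a i) 0 + Num.max (b i) 0) -
   (Num.max (- a i) 0 + Num.max (- b i) 0))); last first.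
  by apply/funext => i; rewrite {1}[a i]posneg {1}[b i]posneg opprD addrACA.
rewrite rsumB.
- by rewrite !nsumD//; try (exact: summ_max); rewrite /rsum opprD addrACA.
- by move=> i; rewrite addr_ge0.
- by move=> i; rewrite addr_ge0.
- by apply: summD; exact: summ_max.
- by apply: summD; exact: summ_max.
Qed.

Lemma rsumN a : rsum (fun i => - a i) = - rsum a.
Proof.
rewrite /rsum opprB; congr (nsum _ - nsum _).
by apply/funext => i; rewrite opprK.
Qed.

Lemma rsumZ k a : summ a -> rsum (fun i => k * a i) = k * rsum a.
Proof.
wlog k0 : k / 0 <= k => [H|sa].
  have [/H//|k0 sa] := leP 0 k.
  rewrite -[k]opprK mulNr -H ?oppr_ge0 1?ltW//.
  by rewrite -rsumN; congr rsum; apply/funext => i; rewrite mulNr.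
have sa' := summN sa.
rewrite (_ : (fun i => _) =
    (fun i => k * Num.max (a i) 0 - k * Num.max (- a i) 0)); last first.
  by apply/funext => i; rewrite -mulrBr -posneg.
rewrite rsumB ?nsumZ//; try (exact: summ_max).
- by rewrite mulrBr.
- by move=> i; rewrite mulr_ge0.
- by move=> i; rewrite mulr_ge0.
- exact/summZ/summ_max.
- exact/summZ/summ_max.
Qed.

Lemma nsum_split j a : (forall i, 0 <= a i) -> summ a ->
  nsum a = a j + nsum (fun i => if i == j then 0 else a i).
Proof.
move=> a0 sa.
have a0' i : 0 <= (if i == j then 0 else a i) by case: ifP.
have s' : summ (fun i => if i == j then 0 else a i).
  by apply: summ_le sa => i; case: ifP => // _; rewrite normr0.
apply: EFin_inj; rewrite EFinD !nsum_EFin//.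
rewrite (esumID [set j])//; last by move=> i _; rewrite lee_fin.
rewrite setTI esum_set1 ?lee_fin//; congr (_ + _)%E.
rewrite setTI esum_mkcond; apply: eq_esum => i _.
have [->|/eqP ij] := eqVneq i j; first by rewrite memNset//= => h; apply: h.
by rewrite mem_set.
Qed.

Lemma rsum_split j a : summ a ->
  rsum a = a j + rsum (fun i => if i == j then 0 else a i).
Proof.
move=> sa; have sa' := summN sa; rewrite /rsum.
rewrite (@nsum_split j (fun i => Num.max (a i) 0))//; last exact: summ_max.
rewrite (@nsum_split j (fun i => Num.max (- a i) 0))//; last exact: summ_max.
rewrite opprD addrACA -posneg; congr (_ + (nsum _ - nsum _)).
all: by apply/funext => i; case: ifP => //; rewrite ?oppr0 maxxx.
Qed.

End RealSums.

Lemma summ_reindex (R : realType) (I J : choiceType) (e : I -> J) (a : J -> R) :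
  bijective e -> summ a -> summ (fun i => a (e i)).
Proof.
rewrite -setTT_bijective => be /summP h; apply/summP.
by rewrite -(@reindex_esum R _ _ setT setT e (fun j => `|a j|%:E)).
Qed.

Lemma rsum_reindex (R : realType) (I J : choiceType) (e : I -> J) (a : J -> R) :
  bijective e -> rsum (fun i => a (e i)) = rsum a.
Proof.
rewrite -setTT_bijective => be; rewrite /rsum /nsum.
rewrite -(@reindex_esum R _ _ setT setT e (fun j => (Num.max (a j) 0)%:E))//.
by rewrite -(@reindex_esum R _ _ setT setT e (fun j => (Num.max (- a j) 0)%:E)).
Qed.

Section ComplexSums.
Context (R : realType) (I : choiceType).
Implicit Types z w : I -> R[i].

Definition csummable z := summ (fun i => complex.Re (z i)) /\ summ (fun i => complex.Im (z i)).
Definition csum z : R[i] :=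
  (rsum (fun i => complex.Re (z i)) +i* rsum (fun i => complex.Im (z i)))%C.

Lemma csumD z w : csummable z -> csummable w ->
  csum (fun i => z i + w i) = csum z + csum w.
Proof.
move=> [a b] [c d]; apply/eqP; rewrite eq_complex /=.
rewrite -!rsumD//; apply/andP; split; apply/eqP; congr rsum; apply/funext => i.
all: by rewrite raddfD.
Qed.

Let ReM (x y : R[i]) : complex.Re (x * y) =
  complex.Re x * complex.Re y + - complex.Im x * complex.Im y.
Proof. by case: x => ? ?; case: y => ? ? /=; rewrite mulNr. Qed.
Let ImM (x y : R[i]) : complex.Im (x * y) =
  complex.Re x * complex.Im y + complex.Im x * complex.Re y.
Proof. by case: x => ? ?; case: y => ? ? /=. Qed.

Lemma csumZ k z : csummable z -> csum (fun i => k * z i) = k * csum z.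
Proof.
move=> [a b]; apply/eqP; rewrite eq_complex ReM ImM /=.
under [X in rsum X == _]eq_fun do rewrite ReM.
under [X in _ && (rsum X == _)]eq_fun do rewrite ImM.
by rewrite !rsumD ?rsumZ ?eqxx//; exact: summZ.
Qed.

Lemma csumJ z : csum (fun i => (z i)^*%C) = (csum z)^*%C.
Proof.
rewrite /csum /=; apply/eqP; rewrite eq_complex/= -rsumN.
by apply/andP; split; apply/eqP; congr rsum; apply/funext => i; case: (z i).
Qed.

Lemma csummable_if (b : pred I) z :
  csummable z -> csummable (fun i => if b i then 0 else z i).
Proof.
move=> [x y]; split; [apply: summ_le x => i|apply: summ_le y => i].
all: by case: (b i) => //; rewrite [X in `|X| <= _](_ : _ = 0) ?normr0.
Qed.

Lemma csum_split j z : csummable z ->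
  csum z = z j + csum (fun i => if i == j then 0 else z i).
Proof.
move=> [a b]; apply/eqP; rewrite eq_complex /= !raddfD/=.
rewrite (rsum_split j a) (rsum_split j b).
by apply/andP; split; apply/eqP; congr (_ + rsum _); apply/funext => i; case: ifP.
Qed.

Lemma csum_ge0 z : (forall i, 0 <= z i) -> csummable z ->
  csum z = (nsum (fun i => complex.Re (z i)))%:C%C.
Proof.
move=> z0 [a b]; apply/eqP; rewrite eq_complex/= rsum_nsum ?eqxx//=; last first.
  by move=> i; have := z0 i; rewrite lecE => /andP[].
have -> : (fun i => complex.Im (z i)) = (fun=> 0 * 0).
  by apply/funext => i; rewrite (ger0_Im (z0 i)) mulr0.
by rewrite rsumZ ?mul0r//; exists 0 => J; rewrite big1// => i _; rewrite normr0.
Qed.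

End ComplexSums.

Lemma csum_reindex (R : realType) (I J : choiceType) (e : I -> J) (a : J -> R[i]) :
  bijective e -> csum (fun i => a (e i)) = csum a.
Proof.
move=> be; rewrite /csum (@rsum_reindex _ _ _ e (fun j => complex.Re (a j)))//.
by rewrite (@rsum_reindex _ _ _ e (fun j => complex.Im (a j))).
Qed.

(** * Norms and inner products over the complex numbers *)

Section ComplexModulus.
Context (R : realType).
Implicit Types z w : R[i].

Lemma cnormE z : `|z| = (rnorm z)%:C%C.
Proof. by rewrite normc_def. Qed.

Lemma cnorm_ge0 z : 0 <= rnorm z.
Proof. by rewrite -lecR -cnormE; exact: normr_ge0. Qed.

Lemma cnormD z w : rnorm (z + w) <= rnorm z + rnorm w.
Proof. by rewrite -lecR raddfD /= -!cnormE ler_normD. Qed.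

Lemma cnormM z w : rnorm (z * w) = rnorm z * rnorm w.
Proof. by apply: complexI; rewrite rmorphM/= -!cnormE normrM. Qed.

Lemma cnorm_real (a : R) : rnorm (a%:C%C) = `|a|.
Proof. by rewrite normc_def /= expr0n/= addr0 sqrtr_sqr. Qed.

Lemma cnormE2 z : rnorm z = Num.sqrt (complex.Re z ^+ 2 + complex.Im z ^+ 2).
Proof. by rewrite normc_def. Qed.

Lemma Re_le_cnorm z : `|complex.Re z| <= rnorm z.
Proof.
by rewrite cnormE2 -sqrtr_sqr ler_sqrt ?lerDl ?addr_ge0 ?sqr_ge0.
Qed.

Lemma Im_le_cnorm z : `|complex.Im z| <= rnorm z.
Proof.
by rewrite cnormE2 -sqrtr_sqr ler_sqrt ?lerDr ?addr_ge0 ?sqr_ge0.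
Qed.

Lemma cnorm_le z : rnorm z <= `|complex.Re z| + `|complex.Im z|.
Proof.
rewrite cnormE2 -[leRHS]ger0_norm ?addr_ge0// -sqrtr_sqr ler_sqrt ?sqr_ge0//.
rewrite sqrrD !real_normK ?num_real// addrAC lerDl.
by rewrite -mulr_natl !mulr_ge0.
Qed.

End ComplexModulus.

Section RealNorm.
Context (R : realType) (V : normedModType R[i]).
Implicit Types x y : V.

Lemma normE x : `|x| = (rnorm x)%:C%C.
Proof. by rewrite RRe_real// ger0_real. Qed.

Lemma rnorm_ge0 x : 0 <= rnorm x.
Proof. by rewrite -lecR -normE; exact: normr_ge0. Qed.

Lemma rnormD x y : rnorm (x + y) <= rnorm x + rnorm y.
Proof. by rewrite -lecR raddfD /= -!normE ler_normD. Qed.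

Lemma rnormN x : rnorm (- x) = rnorm x.
Proof. by rewrite normrN. Qed.

Lemma rnormZ (k : R[i]) x : rnorm (k *: x) = rnorm k * rnorm x.
Proof. by apply: complexI; rewrite rmorphM/= -(normE (k *: x)) normrZ normE cnormE. Qed.

Lemma rnorm0 : rnorm (0 : V) = 0.
Proof. by rewrite normr0. Qed.

Lemma rnorm0_eq0 x : rnorm x = 0 -> x = 0.
Proof. by move=> x0; apply/eqP; rewrite -normr_eq0 normE x0. Qed.

Lemma ler_rnorm_dist x y z : `|rnorm (x - y) - rnorm (x - z)| <= rnorm (y - z).
Proof.
have h1 : rnorm (x - y) <= rnorm (x - z) + rnorm (y - z).
  by rewrite -(rnormN (y - z)) opprB (le_trans _ (rnormD _ _))// addrA subrK.
have h2 : rnorm (x - z) <= rnorm (x - y) + rnorm (y - z).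
  by rewrite (le_trans _ (rnormD _ _))// addrA subrK.
by rewrite ler_norml; apply/andP; split; lra.
Qed.

Lemma lt_rnorm x (e : R[i]) : 0 < e -> (`|x| < e) = (rnorm x < complex.Re e).
Proof. by case: e => a b; rewrite ltcE/= => /andP[/eqP-> _]; rewrite normE ltcR. Qed.

Lemma Re_gt0 (e : R[i]) : 0 < e -> 0 < complex.Re e.
Proof. by rewrite ltcE => /andP[]. Qed.

End RealNorm.

Section HilbertBasics.
Context (R : realType) (H : hilbertSpace R).
Implicit Types x y : H.

Lemma dot_norm x : dot H x x = (rnorm x ^+ 2)%:C%C.
Proof. by case: H x => V D e x; rewrite -e normE rmorphXn. Qed.

Lemma dotC x y : dot H x y = (dot H y x)^*%C.
Proof. by rewrite (@hermC _ _ _ _ (dot H)) expr0 mul1r. Qed.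

Lemma dotDl x y z : dot H (x + y) z = dot H x z + dot H y z.
Proof. exact: (@linearDl _ _ _ _ _ _ (dot H)). Qed.

Lemma dotDr x y z : dot H x (y + z) = dot H x y + dot H x z.
Proof. exact: (@linearDr _ _ _ _ _ _ (dot H)). Qed.

Lemma dotZl k x y : dot H (k *: x) y = k * dot H x y.
Proof. exact: (@linearZl_LR _ _ _ _ _ _ (dot H)). Qed.

Lemma dotZr k x y : dot H x (k *: y) = k^*%C * dot H x y.
Proof. by rewrite dotC dotZl rmorphM/= -dotC. Qed.

Lemma dot0l y : dot H 0 y = 0.
Proof. by rewrite -(scale0r (0 : H)) dotZl mul0r. Qed.

Lemma dot0r y : dot H y 0 = 0.
Proof. by rewrite dotC dot0l rmorph0. Qed.

Lemma dot_suml (T : Type) (s : seq T) (F : T -> H) y :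
  dot H (\sum_(t <- s) F t) y = \sum_(t <- s) dot H (F t) y.
Proof.
by rewrite (big_morph (fun x => dot H x y) (fun a b => dotDl a b y) (dot0l y)).
Qed.

Lemma dot_sumr (T : Type) (s : seq T) (F : T -> H) y :
  dot H y (\sum_(t <- s) F t) = \sum_(t <- s) dot H y (F t).
Proof. by rewrite (big_morph (dot H y) (dotDr y) (dot0r y)). Qed.

Lemma rnormD_sqr x y :
  rnorm (x + y) ^+ 2 = rnorm x ^+ 2 + rnorm y ^+ 2 + 2 * complex.Re (dot H x y).
Proof.
apply: complexI; rewrite -dot_norm dotDl !dotDr !dot_norm [dot H y x]dotC.
rewrite !rmorphD (rmorphM _ 2) rmorph_nat /= -addcJ.
by rewrite addrA -[X in X + _]addrA addrAC.
Qed.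

(** A substitute for the Cauchy-Schwarz inequality that is good enough to sum
    coordinatewise inner products: expand the squared norms of x + y and x - y. *)
Lemma Re_dot_le x y :
  `|complex.Re (dot H x y)| <= rnorm x ^+ 2 + rnorm y ^+ 2.
Proof.
have := rnormD_sqr x y; have := rnormD_sqr x (- y).
rewrite rnormN -scaleN1r dotZr rmorphN rmorph1 mulN1r raddfN/=.
have := sqr_ge0 (rnorm (x + y)); have := sqr_ge0 (rnorm (x + (-1) *: y)).
by move: (sqr_ge0 (rnorm x)) (sqr_ge0 (rnorm y)) => *; rewrite ler_norml; lra.
Qed.

Lemma Im_dot_le x y :
  `|complex.Im (dot H x y)| <= rnorm x ^+ 2 + rnorm y ^+ 2.
Proof.
have := Re_dot_le x ('i%C *: y).
have -> : complex.Re (dot H x ('i%C *: y)) = complex.Im (dot H x y).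
  by rewrite dotZr; case: (dot H x y) => a b /=; ring.
by rewrite rnormZ cnormE2/= expr0n/= add0r expr1n sqrtr1 mul1r.
Qed.

End HilbertBasics.

(** * The Hilbert space of square summable vector-valued functions *)

Section L2Space.
Context (R : realType) (I : choiceType) (V : hilbertSpace R).

Definition l2_pred : pred (I -> V) :=
  [pred f : I -> V | `[< summ (fun i => rnorm (f i) ^+ 2) >] ].

Record l2 := L2 { l2val :> I -> V ; _ : l2val \in l2_pred }.
HB.instance Definition _ := [isSub for l2val].
HB.instance Definition _ := [Choice of l2 by <:].

Lemma l2_predP (f : I -> V) :
  f \in l2_pred <-> summ (fun i => rnorm (f i) ^+ 2).
Proof. by split=> [/asboolP|?]; [|apply/asboolP]. Qed.

Lemma l2_summ (f : l2) : summ (fun i => rnorm (f i) ^+ 2).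
Proof. by case: f => f /= /l2_predP. Qed.

Lemma l2_submod_closed : submod_closed l2_pred.
Proof.
split=> [|k f g /l2_predP sf /l2_predP sg]; apply/l2_predP.
  exists 0 => J; rewrite big1// => i _.
  by rewrite [rnorm _]rnorm0 expr0n normr0.
apply: summ_le (summD (summZ (2 * rnorm k ^+ 2) sf) (summZ 2 sg)) => i.
rewrite (ger0_norm (sqr_ge0 _)) ger0_norm; last first.
  by rewrite addr_ge0// !(sqr_ge0, mulr_ge0).
rewrite -[(_ + _) i]/(k *: f i + g i).
apply: (@le_trans _ _ ((rnorm (k *: f i) + rnorm (g i)) ^+ 2)).
  by rewrite ler_sqr ?nnegrE ?addr_ge0 ?rnorm_ge0 ?rnormD.
rewrite rnormZ -mulrA -exprMn; set a := _ * rnorm (f i); set b := rnorm (g i).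
by rewrite -subr_ge0 (_ : _ - _ = (a - b) ^+ 2) ?sqr_ge0//; ring.
Qed.

HB.instance Definition _ := GRing.isSubmodClosed.Build _ _ l2_pred l2_submod_closed.
HB.instance Definition _ := [SubChoice_isSubLmodule of l2 by <:].

Implicit Types f g h : l2.

Lemma l2D f g i : (f + g) i = f i + g i. Proof. by []. Qed.
Lemma l2Z k f i : (k *: f) i = k *: f i. Proof. by []. Qed.
Lemma l2N f i : (- f) i = - f i. Proof. by []. Qed.
Lemma l20 i : (0 : l2) i = 0. Proof. by []. Qed.
Lemma l2P f g : (forall i, f i = g i) -> f = g.
Proof. by move=> fg; apply: val_inj; apply/funext. Qed.
Lemma l2_sum (T : Type) (s : seq T) (F : T -> l2) i :
  (\sum_(t <- s) F t) i = \sum_(t <- s) F t i.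
Proof. by elim/big_rec2: _ => [|t x y _ <-]; rewrite ?l20 ?l2D. Qed.

Definition l2sq f : R := nsum (fun i => rnorm (f i) ^+ 2).
Definition l2nm f : R := Num.sqrt (l2sq f).

Lemma l2sq_ge0 f : 0 <= l2sq f.
Proof. by apply: nsum_ge0 => i; exact: sqr_ge0. Qed.

Lemma l2nm_ge0 f : 0 <= l2nm f. Proof. exact: sqrtr_ge0. Qed.

Lemma l2nm_sqr f : l2nm f ^+ 2 = l2sq f.
Proof. by rewrite sqr_sqrtr// l2sq_ge0. Qed.

Lemma l2sq_ge f (J : {fset I}) : \sum_(i <- J) rnorm (f i) ^+ 2 <= l2sq f.
Proof. by apply: nsum_ge (l2_summ f) => i; exact: sqr_ge0. Qed.

Lemma l2nm_le f (M : R) : 0 <= M ->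
  (forall J : {fset I}, \sum_(i <- J) rnorm (f i) ^+ 2 <= M ^+ 2) -> l2nm f <= M.
Proof.
move=> M0 fM; rewrite -(ler_sqr (l2nm_ge0 f) M0) l2nm_sqr.
by apply: nsum_le => // i; exact: sqr_ge0.
Qed.

Lemma coord_le_l2nm f i : rnorm (f i) <= l2nm f.
Proof.
rewrite -ler_sqr ?nnegrE ?l2nm_ge0 ?rnorm_ge0// l2nm_sqr.
by have := l2sq_ge f [fset i]%fset; rewrite big_seq_fset1.
Qed.

Lemma l2sqZ k f : l2sq (k *: f) = rnorm k ^+ 2 * l2sq f.
Proof.
rewrite -nsumZ ?sqr_ge0//; last exact: l2_summ.
  by congr nsum; apply/funext => i; rewrite l2Z rnormZ exprMn.
by move=> i; exact: sqr_ge0.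
Qed.

Lemma l2nmZ k f : l2nm (k *: f) = rnorm k * l2nm f.
Proof. by rewrite /l2nm l2sqZ sqrtrM ?sqr_ge0// sqrtr_sqr ger0_norm// cnorm_ge0. Qed.

Lemma l2nm0_eq0 f : l2nm f = 0 -> f = 0.
Proof.
move=> f0; apply: l2P => i; apply: rnorm0_eq0; apply/eqP.
by rewrite eq_le rnorm_ge0 -f0 coord_le_l2nm.
Qed.

(** Minkowski's inequality without Cauchy-Schwarz: with a and b the two norms,
    (x + y)^2 <= (1 + b/a) x^2 + (1 + a/b) y^2 holds coordinatewise and sums up
    to (a + b)^2. *)
Lemma l2nmD f g : l2nm (f + g) <= l2nm f + l2nm g.
Proof.
have [/l2nm0_eq0->|f0] := eqVneq (l2nm f) 0.
  by rewrite add0r lerDr l2nm_ge0.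
have [/l2nm0_eq0->|g0] := eqVneq (l2nm g) 0.
  by rewrite addr0 lerDl l2nm_ge0.
set a := l2nm f; set b := l2nm g.
have a0 : 0 < a by rewrite lt_def f0 l2nm_ge0.
have b0 : 0 < b by rewrite lt_def g0 l2nm_ge0.
apply: l2nm_le => [|J]; first by rewrite addr_ge0 ?ltW.
have -> : (a + b) ^+ 2 = (1 + b / a) * a ^+ 2 + (1 + a / b) * b ^+ 2.
  by field; rewrite !gt_eqF.
rewrite !l2nm_sqr; apply: le_trans (lerD (ler_wpM2l _ (l2sq_ge f J))
  (ler_wpM2l _ (l2sq_ge g J))); last 2 first.
  by rewrite addr_ge0// divr_ge0 ?ltW.
  by rewrite addr_ge0// divr_ge0 ?ltW.
rewrite !mulr_sumr -big_split/=; apply: ler_sum => i _.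
apply: (@le_trans _ _ ((rnorm (f i) + rnorm (g i)) ^+ 2)).
  by rewrite ler_sqr ?nnegrE ?addr_ge0 ?rnorm_ge0 ?rnormD.
set x := rnorm (f i); set y := rnorm (g i); rewrite -subr_ge0.
have -> : (1 + b / a) * x ^+ 2 + (1 + a / b) * y ^+ 2 - (x + y) ^+ 2 =
   (a * b)^-1 * (b * x - a * y) ^+ 2 by field; rewrite !gt_eqF.
by rewrite mulr_ge0 ?sqr_ge0// invr_ge0 mulr_ge0 ?ltW.
Qed.

Let nmC f : R[i] := (l2nm f)%:C%C.
Let nmCD f g : nmC (f + g) <= nmC f + nmC g.
Proof. by rewrite -rmorphD lecR l2nmD. Qed.
Let nmCZ k f : nmC (k *: f) = `|k| * nmC f.
Proof. by rewrite /nmC l2nmZ rmorphM/= -cnormE. Qed.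
Let nmC0_eq0 f : nmC f = 0 -> f = 0.
Proof. by move=> [/l2nm0_eq0]. Qed.

HB.instance Definition _ := Lmodule_isNormed.Build R[i] l2 nmCD nmCZ nmC0_eq0.

Lemma l2_rnorm f : rnorm f = l2nm f. Proof. by []. Qed.

(** Coordinates are 1-Lipschitz, so a Cauchy filter has a coordinatewise limit l.
    A ball of radius e that belongs to the filter controls every finite partial
    sum of |f - l|^2 by e^2, by letting the other point tend to l in finitely
    many coordinates; this shows both that l is square summable and that the
    filter converges to it in norm. *)
Lemma l2_complete (F : set_system l2) : ProperFilter F -> cauchy F -> cvg F.
Proof.
move=> FF /cauchyP Fc.
have Fc' (e : R) : 0 < e -> exists f, F [set g | l2nm (f - g) < e].
  move=> e0; have e0' : 0 < e%:C%C by rewrite ltcR.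
  have [f Ff] := Fc _ e0'; exists f; apply: filterS Ff => g.
  by rewrite -ball_normE /ball_ /= lt_rnorm.
have cvg_coord i : cvg ((fun f : l2 => f i) @ F).
  apply: cauchy_cvg; apply/cauchyP => e e0.
  have [f Ff] := Fc' _ (Re_gt0 e0); exists (f i).
  suff : F [set g : l2 | ball (f i) e (g i)] by [].
  apply: filterS Ff => g fg; rewrite /=; rewrite -ball_normE /ball_ /= lt_rnorm//.
  exact: le_lt_trans (coord_le_l2nm (f - g) i) fg.
pose l i := lim ((fun f : l2 => f i) @ F).
have cvg_l i : (fun f : l2 => rnorm (l i - f i)) @ F --> (0 : R).
  apply/cvgrPdist_lt => e e0; have e0' : 0 < e%:C%C by rewrite ltcR.
  have /cvgrPdist_lt/(_ _ e0') := cvg_coord i.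
  apply: filterS => f; rewrite lt_rnorm//= sub0r normrN ger0_norm//.
  exact: rnorm_ge0.
have fin f (e : R) (J : {fset I}) : 0 < e -> F [set g | l2nm (f - g) < e] ->
    \sum_(i <- J) rnorm (f i - l i) ^+ 2 <= e ^+ 2.
  move=> e0 Ff.
  have c i : (fun g : l2 => rnorm (f i - g i)) @ F --> rnorm (f i - l i).
    apply/cvgrPdist_lt => x x0; have /cvgrPdist_lt/(_ _ x0) := cvg_l i.
    apply: filterS => g; rewrite sub0r normrN ger0_norm ?rnorm_ge0//.
    by apply: le_lt_trans; exact: ler_rnorm_dist.
  have C : (fun g : l2 => \sum_(i <- J) rnorm (f i - g i) ^+ 2) @ F -->
      \sum_(i <- J) rnorm (f i - l i) ^+ 2.
    apply: (@cvg_big _ _ _ _ _ _ _ _ _ (fun i (g : l2) => rnorm (f i - g i) ^+ 2)).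
      exact: add_continuous.
    by move=> i _; rewrite expr2; apply: cvgM; exact: c.
  rewrite -(cvg_lim _ C)//; apply: limr_le; first by apply/cvg_ex; eexists; exact: C.
  apply: filterS Ff => g fg.
  apply: le_trans (l2sq_ge (f - g) J) _.
  by rewrite -l2nm_sqr ler_sqr ?nnegrE ?l2nm_ge0 ?ltW.
have [f1 Ff1] := Fc' _ ltr01.
(* l is the difference of f1 and of the square summable function f1 - l. *)
have l_l2 : l \in l2_pred.
  rewrite (_ : l = l2val f1 - (l2val f1 - l)); last by rewrite opprB addrC subrK.
  apply: rpredB; first exact: valP; apply/l2_predP.
  exists (1 ^+ 2) => J; under eq_bigr do rewrite ger0_norm ?sqr_ge0//.
  exact: fin.
apply/cvg_ex; exists (L2 l_l2); apply/cvgrPdist_lt => e e0.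
have e2 : 0 < complex.Re e / 2 by rewrite divr_gt0// Re_gt0.
have [f Ff] := Fc' _ e2; apply: filterS (Ff) => g fg.
rewrite lt_rnorm// l2_rnorm.
rewrite (_ : _ - g = - (f - L2 l_l2) + (f - g)); last first.
  by rewrite opprB addrA subrK.
rewrite (splitr (complex.Re e)) (le_lt_trans (l2nmD _ _))// ler_ltD//.
rewrite -l2_rnorm normrN l2_rnorm.
by apply: l2nm_le => [|J]; [exact: ltW|exact: fin].
Qed.

HB.instance Definition _ := Uniform_isComplete.Build l2 l2_complete.

Definition l2dot f g : R[i] := csum (fun i => dot V (f i) (g i)).

Lemma l2dot_summable f g : csummable (fun i => dot V (f i) (g i)).
Proof.
have s := summD (l2_summ f) (l2_summ g).
split; apply: summ_le s => i.
all: by rewrite [leRHS]ger0_norm ?addr_ge0 ?sqr_ge0 ?Re_dot_le ?Im_dot_le.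
Qed.

Lemma l2dotDl f g h : l2dot (f + g) h = l2dot f h + l2dot g h.
Proof.
rewrite /l2dot -csumD; try exact: l2dot_summable.
by congr csum; apply/funext => i; rewrite -dotDl.
Qed.

Lemma l2dotZl k f h : l2dot (k *: f) h = k * l2dot f h.
Proof.
rewrite /l2dot -csumZ; last exact: l2dot_summable.
by congr csum; apply/funext => i; rewrite -dotZl.
Qed.

Lemma l2dotC f g : l2dot f g = (l2dot g f)^*%C.
Proof. by rewrite /l2dot -csumJ; congr csum; apply/funext => i; rewrite -dotC. Qed.

Lemma l2dot_norm f : `|f| ^+ 2 = l2dot f f.
Proof.
rewrite normE l2_rnorm -rmorphXn /= l2nm_sqr /l2dot csum_ge0; last exact: l2dot_summable.
  by congr (_%:C%C); congr nsum; apply/funext => i; rewrite dot_norm.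
by move=> i; rewrite dot_norm ler0c sqr_ge0.
Qed.

Lemma l2dot_bilinear :
  bilinear_for ( *%R : GRing.Scale.law R[i] R[i])
    ((@Num.Def.conjC R[i]) \; *%R : GRing.Scale.law R[i] R[i]) l2dot.
Proof.
split=> [h k f g|f k g h] /=; first by rewrite l2dotDl l2dotZl.
by rewrite l2dotC l2dotDl l2dotZl rmorphD rmorphM /= (l2dotC f g) (l2dotC f h).
Qed.

HB.instance Definition _ := bilinear_isBilinear.Build R[i] l2 l2 R[i] _ _ l2dot l2dot_bilinear.

Lemma l2dot_herm f g : l2dot f g = (-1) ^+ false * (@Num.Def.conjC R[i]) (l2dot g f).
Proof. by rewrite expr0 mul1r; exact: l2dotC. Qed.

HB.instance Definition _ :=
  isHermitianSesquilinear.Build R[i] l2 false (@Num.Def.conjC R[i]) l2dot l2dot_herm.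

Lemma l2dot_gt0 f : f != 0 -> 0 < l2dot f f.
Proof. by move=> f0; rewrite -l2dot_norm exprn_gt0// normr_gt0. Qed.

HB.instance Definition _ := isDotProduct.Build R[i] l2 l2dot l2dot_gt0.

Definition l2_hilbert : hilbertSpace R :=
  @HilbertSpace R l2 l2dot l2dot_norm.

End L2Space.
#[global] Arguments l2val : simpl never.

(** * Finitely supported functions *)

Section L2Single.
Context (R : realType) (I : choiceType) (V : hilbertSpace R).
Local Notation l2 := (l2 I V).
Implicit Types (f g h : l2) (v : V).

Let single_fun i v : I -> V := fun j => if j == i then v else 0.

Lemma single_subproof i v : single_fun i v \in @l2_pred R I V.
Proof.
apply/l2_predP; exists (rnorm v ^+ 2) => J.
rewrite (eq_bigr (fun j => if j == i then rnorm v ^+ 2 else 0)); last first.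
  move=> j _; rewrite /single_fun; case: ifP => _; last by rewrite rnorm0 expr0n normr0.
  by rewrite ger0_norm ?sqr_ge0.
rewrite -big_mkcond; have [iJ|iJ] := boolP (i \in J).
  by rewrite -big_filter filter_pred1_uniq ?fset_uniq// big_seq1.
by rewrite big_seq_cond big_pred0 ?sqr_ge0// => j; case: eqP => [->|]; rewrite ?(negbTE iJ) ?andbF.
Qed.

Definition single i v : l2 := L2 (single_subproof i v).

Lemma singleE i v j : single i v j = if j == i then v else 0. Proof. by []. Qed.

Lemma single_is_linear i : linear (single i).
Proof.
by move=> k v w; apply: l2P => j; rewrite l2D l2Z !singleE; case: ifP; rewrite ?scaler0 ?addr0.
Qed.
HB.instance Definition _ i := GRing.isLinear.Build R[i] V l2 _ (single i) (single_is_linear i).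

Lemma csum0 : csum (fun _ : I => 0 : R[i]) = 0.
Proof.
have s : csummable (fun _ : I => 0 : R[i]).
  by split; exists 0 => J; rewrite big1// => i _; rewrite normr0.
by have := csumZ 0 s; rewrite [RHS]mul0r => h; rewrite -[RHS]h; congr csum; apply/funext => i; rewrite mul0r.
Qed.

Lemma dot_single f i v : dot (l2_hilbert I V) f (single i v) = dot V (f i) v.
Proof.
rewrite /= /l2dot (csum_split i); last exact: l2dot_summable.
rewrite singleE eqxx -[RHS]addr0; congr (_ + _).
rewrite -[RHS]csum0; congr csum; apply/funext => j.
by rewrite singleE; case: eqP => _ /=; rewrite ?dot0r.
Qed.

Lemma l2nm_single i v : l2nm (single i v) = rnorm v.
Proof.
apply/eqP; rewrite eq_le; apply/andP; split; last first.
  by have := coord_le_l2nm (single i v) i; rewrite singleE eqxx.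
rewrite -ler_sqr ?nnegrE ?l2nm_ge0 ?rnorm_ge0// -lecR.
have := dot_norm (single i v : l2_hilbert I V).
by rewrite dot_single singleE eqxx dot_norm l2_rnorm => ->.
Qed.

Definition restr (J : {fset I}) f : l2 := \sum_(i <- J) single i (f i).

Lemma restrE J f i : restr J f i = if i \in J then f i else 0.
Proof.
rewrite l2_sum (eq_bigr (fun j => if i == j then f i else 0)); last first.
  by move=> j _; rewrite singleE; case: eqP => // ->.
rewrite -big_mkcond; have [iJ|iJ] := boolP (i \in J).
  rewrite (eq_bigl (pred1 i)); last by move=> j; rewrite /= eq_sym.
  by rewrite -big_filter filter_pred1_uniq ?fset_uniq// big_seq1.
rewrite big_seq_cond big_pred0// => j.
by case: (i =P j) => [<-|]; rewrite ?(negbTE iJ) ?andbF.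
Qed.

Lemma restr_supp J f : (forall i, i \notin J -> f i = 0) -> f = restr J f.
Proof. by move=> fJ; apply: l2P => i; rewrite restrE; case: ifPn => [|/fJ]. Qed.

(** Choose J so that its partial sum is within e^2 of the supremum. *)
Lemma restr_approx f (e : R) : 0 < e -> exists J, l2nm (f - restr J f) <= e.
Proof.
move=> e0; have e20 : 0 < e ^+ 2 by rewrite exprn_gt0.
have [J fJ] : exists J : {fset I}, l2sq f - e ^+ 2 < \sum_(i <- J) rnorm (f i) ^+ 2.
  apply: contrapT => /forallNP nJ.
  have : l2sq f <= l2sq f - e ^+ 2.
    apply: nsum_le => [i|J]; first exact: sqr_ge0.
    by rewrite leNgt; apply/negP/nJ.
  by rewrite leNgt ltrBlDr ltrDl e20.
pose g : l2 := f - restr J f.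
have gE i : g i = if i \in J then 0 else f i.
  by rewrite /g l2D l2N restrE; case: ifP; rewrite ?subrr ?subr0.
exists J; rewrite -/g; apply: l2nm_le => [|J']; first exact: ltW.
have : \sum_(i <- (J `|` J')%fset) rnorm (f i) ^+ 2 <= l2sq f by exact: l2sq_ge.
suff <- : \sum_(i <- J) rnorm (f i) ^+ 2 +
    \sum_(i <- J') rnorm (g i) ^+ 2 =
    \sum_(i <- (J `|` J')%fset) rnorm (f i) ^+ 2 by move: fJ => *; lra.
rewrite [RHS](bigID (mem J))/=; congr (_ + _).
  rewrite -[RHS]big_filter; apply: perm_big; apply: uniq_perm.
  - exact: fset_uniq.
  - by rewrite filter_uniq ?fset_uniq.
  - by move=> i; rewrite mem_filter inE; case: (i \in J).
rewrite [LHS](bigID (mem J))/= big1 ?add0r; last first.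
  by move=> i iJ; rewrite gE iJ rnorm0 expr0n.
rewrite -[LHS]big_filter -[RHS]big_filter.
rewrite [RHS](perm_big [seq i <- J' | i \notin J]); last first.
  apply: uniq_perm; rewrite ?filter_uniq ?fset_uniq// => i.
  by rewrite !mem_filter inE; case: (i \in J).
rewrite !big_filter; apply: eq_bigr => i iJ.
by rewrite gE (negbTE iJ).
Qed.

Lemma denseP (W : normedModType R[i]) (K : set W) :
  dense K <-> forall x (e : R), 0 < e -> exists2 y, K y & rnorm (x - y) < e.
Proof.
split=> [dK x e e0|dK O [x Ox] oO].
  have e0' : 0 < e%:C%C by rewrite ltcR.
  have [|y] := dK (ball x e%:C%C)^° _ (@open_interior _ _).
    by exists x; apply: nbhsx_ballx.
  case=> /interior_subset + Ky; rewrite -ball_normE /ball_/= lt_rnorm// => xy.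
  by exists y.
have /nbhs_ballP[e e0 eO] := open_nbhs_nbhs (conj oO Ox).
have [y Ky xy] := dK x _ (Re_gt0 e0); exists y; split=> //; apply: eO.
by rewrite -ball_normE /ball_/= lt_rnorm.
Qed.

Definition finsupp_in (K : set V) : set l2 :=
  [set f | (forall i, K (f i)) /\ exists J : {fset I}, forall i, i \notin J -> f i = 0].

Lemma finsupp_in_subspace K : is_subspace K -> is_subspace (finsupp_in K).
Proof.
move=> [K0 Kl]; split=> [|k f g [Kf [J fJ]] [Kg [J' gJ']]].
  by split=> [i|]; [rewrite l20|exists fset0 => i _; rewrite l20].
split=> [i|]; first by rewrite l2D l2Z; exact: Kl.
exists (J `|` J')%fset => i; rewrite inE negb_or => /andP[/fJ fi /gJ' gi].
by rewrite l2D l2Z fi gi scaler0 addr0.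
Qed.

Lemma finsupp_in_single K i v : is_subspace K -> K v -> finsupp_in K (single i v).
Proof.
move=> [K0 _] Kv; split=> [j|]; first by rewrite singleE; case: ifP.
by exists [fset i]%fset => j; rewrite inE singleE => /negbTE->.
Qed.

(** Cut off outside a finite set J, then approximate the finitely many remaining
    values, each within e / (2 (|J| + 1)). *)
Lemma finsupp_in_dense K : is_subspace K -> dense K -> dense (finsupp_in K).
Proof.
move=> Ks Kd; apply/(denseP (finsupp_in K)) => f e e0.
have e2 : 0 < e / 2 by rewrite divr_gt0.
have [J fJ] := restr_approx f e2.
have d0 : 0 < e / 2 / (size J).+1%:R by rewrite divr_gt0.
have /choice[k kP] : forall i, exists y, K y /\ rnorm (f i - y) < e / 2 / (size J).+1%:R.
  by move=> i; have [y Ky fy] := (denseP K).1 Kd (f i) _ d0; exists y.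
have [S0 Sl] := finsupp_in_subspace Ks.
exists (\sum_(i <- J) single i (k i)).
  elim/big_ind: _ => // [x y Sx Sy|i _].
    by have := Sl 1 _ _ Sx Sy; rewrite scale1r.
  by apply: finsupp_in_single => //; exact: (kP i).1.
rewrite l2_rnorm (_ : f - _ = (f - restr J f) + \sum_(i <- J) single i (f i - k i)).
  apply: le_lt_trans (l2nmD _ _) _; rewrite (splitr e) ler_ltD//.
  apply: (@le_lt_trans _ _ (\sum_(i <- J) (e / 2 / (size J).+1%:R))).
    set D := e / 2 / _ in kP *; elim: (enum_fset J) => [|i s IH]; first by rewrite !big_nil -l2_rnorm rnorm0.
    rewrite !big_cons; apply: le_trans (l2nmD _ _) _; apply: lerD => //.
    by rewrite l2nm_single ltW// (kP i).2.
  rewrite big_const_seq count_predT iter_addr_0.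
  rewrite -[ltRHS](@divfK _ (size J).+1%:R) ?pnatr_eq0//.
  by rewrite -[ltLHS]mulr_natr ltr_pM2l// ltr_nat.
rewrite [X in _ = _ + X](eq_bigr (fun i => single i (f i) - single i (k i))); last first.
  by move=> i _; rewrite raddfB.
by rewrite sumrB /restr addrA subrK.
Qed.

End L2Single.

(** * The complex line *)

Section ComplexLine.
Context (R : realType).

(** A name of its own for the normed line, so that completeness is attached to
    this type and not to every regular module. *)
Definition cline : Type := R[i]^o.
HB.instance Definition _ := NormedModule.copy cline R[i]^o.

Lemma complex_complete (F : set_system cline) : ProperFilter F -> cauchy F -> cvg F.
Proof.
move=> FF /cauchyP Fc.
have part (h : R[i] -> R) : (forall z w, `|h z - h w| <= rnorm (z - w)) ->
    cvg (h @ F).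
  move=> hle; apply: cauchy_cvg; apply/cauchyP => e e0.
  have e0' : 0 < e%:C%C by rewrite ltcR.
  have [z Fz] := Fc _ e0'; exists (h z).
  suff : F [set w | ball (h z) e (h w)] by [].
  apply: filterS Fz => w; rewrite -!ball_normE /ball_/= => zw.
  by apply: le_lt_trans (hle z w) _; rewrite -ltcR -cnormE.
have cR : cvg ((fun z => complex.Re z) @ F).
  by apply: part => z w; rewrite -raddfB; exact: Re_le_cnorm.
have cI : cvg ((fun z => complex.Im z) @ F).
  by apply: part => z w; rewrite -raddfB; exact: Im_le_cnorm.
pose l : cline := (lim ((fun z => complex.Re z) @ F) +i*
                 lim ((fun z => complex.Im z) @ F))%C.
apply/cvg_ex; exists l; apply/cvgrPdist_lt => e e0.
have e2 : 0 < complex.Re e / 2 by rewrite divr_gt0// Re_gt0.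
have /cvgrPdist_lt/(_ _ e2) FR := cR; have /cvgrPdist_lt/(_ _ e2) FI := cI.
apply: filterS (filterI FR FI) => z [zR zI].
rewrite lt_rnorm// (le_lt_trans (cnorm_le _))// (splitr (complex.Re e)).
by rewrite !raddfB ltrD.
Qed.

HB.instance Definition _ := Uniform_isComplete.Build cline complex_complete.

Definition cdot (z w : cline) : R[i] := z * w^*%C.

Lemma cdot_bilinear :
  bilinear_for ( *%R : GRing.Scale.law R[i] R[i])
    ((@Num.Def.conjC R[i]) \; *%R : GRing.Scale.law R[i] R[i]) cdot.
Proof.
split=> [w k x y|w k x y] /=; rewrite /cdot.
  by rewrite mulrDl -mulrA.
by rewrite rmorphD rmorphM mulrDr mulrCA.
Qed.

HB.instance Definition _ :=
  bilinear_isBilinear.Build R[i] cline cline R[i] _ _ cdot cdot_bilinear.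

Lemma cdot_herm x y : cdot x y = (-1) ^+ false * (@Num.Def.conjC R[i]) (cdot y x).
Proof. by rewrite expr0 mul1r /cdot [RHS]rmorphM/= conjCK mulrC. Qed.

HB.instance Definition _ :=
  isHermitianSesquilinear.Build R[i] cline false (@Num.Def.conjC R[i]) cdot cdot_herm.

Lemma cdot_norm (x : cline) : `|x| ^+ 2 = cdot x x.
Proof. exact: sqr_normc. Qed.

Lemma cdot_gt0 x : x != 0 -> 0 < cdot x x.
Proof. by move=> f0; rewrite -cdot_norm exprn_gt0// normr_gt0. Qed.

HB.instance Definition _ := isDotProduct.Build R[i] cline cdot cdot_gt0.

Definition complex_hilbert : hilbertSpace R :=
  @HilbertSpace R cline cdot cdot_norm.

End ComplexLine.

(** * Haagerup's deformation of a representation of the free group *)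

Section LetterOperators.
Context (R : realType) (d : nat) (H : hilbertSpace R)
        (u : unitary_rep (free_group d) H).
Context (r c : R) (rc1 : r ^+ 2 + c ^+ 2 = 1).
Local Notation G := (free_group d).
Local Notation l2 := (l2 G H).

Definition gen (a : letter d) : G := @FreeGroup d [:: a] isT.

Lemma gen_neq1 a : gen a != 1%g. Proof. by []. Qed.

Lemma genV a : ((gen a)^-1)%g = gen (letter_inv a).
Proof. by apply: val_inj. Qed.

Lemma urep1 x : u 1%g x = x. Proof. by case: u. Qed.
Lemma urepM g h x : u (g * h)%g x = u g (u h x). Proof. by case: u. Qed.
Lemma urep_dot g x y : dot H (u g x) (u g y) = dot H x y. Proof. by case: u. Qed.
Lemma urep_rnorm g x : rnorm (u g x) = rnorm x.
Proof.
apply/eqP; rewrite -(@eqrXn2 _ 2) ?rnorm_ge0//; apply/eqP.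
by have := urep_dot g x x; rewrite !dot_norm => -[].
Qed.
Lemma urepK g x : u g (u g^-1%g x) = x. Proof. by rewrite -urepM mulgV urep1. Qed.
Lemma urepKV g x : u g^-1%g (u g x) = x. Proof. by rewrite -urepM mulVg urep1. Qed.

Lemma mulg_bij (g : G) : bijective (fun x => g * x)%g.
Proof. by exists (fun x => g^-1 * x)%g => x; rewrite mulgA ?mulVg ?mulgV mul1g. Qed.

Let shift_fun a (f : l2) : G -> H := fun x => u (gen a) (f ((gen a)^-1 * x)%g).

Lemma shift_subproof a f : shift_fun a f \in @l2_pred R G H.
Proof.
apply/l2_predP; rewrite /shift_fun; under eq_fun do rewrite urep_rnorm.
exact: (summ_reindex (a := fun x => rnorm (f x) ^+ 2) (mulg_bij _) (l2_summ f)).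
Qed.

Definition shift a f : l2 := L2 (shift_subproof a f).

Lemma shiftE a f x : shift a f x = u (gen a) (f ((gen a)^-1 * x)%g).
Proof. by []. Qed.

Lemma shift_dot a f h : l2dot (shift a f) (shift a h) = l2dot f h.
Proof.
rewrite /l2dot; under eq_fun do rewrite !shiftE urep_dot.
exact: (csum_reindex (fun x => dot H (f x) (h x)) (mulg_bij _)).
Qed.

(** The rotation of angle arccos c in the plane spanned by the vertices 1 and a
    of the Cayley tree, written as a finitely supported correction to the
    identity so that square summability is clear. *)
Definition rot (a : letter d) (f : l2) : l2 :=
  f + single 1%g ((c - 1)%:C%C *: f 1%g + r%:C%C *: f (gen a))
    + single (gen a) ((c - 1)%:C%C *: f (gen a) - r%:C%C *: f 1%g).

Lemma rotE a f x : rot a f x =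
  if x == 1%g then c%:C%C *: f 1%g + r%:C%C *: f (gen a)
  else if x == gen a then c%:C%C *: f (gen a) - r%:C%C *: f 1%g else f x.
Proof.
have E v : v + (c - 1)%:C%C *: v = c%:C%C *: v :> H.
  by rewrite rmorphB scalerBl scale1r addrC subrK.
rewrite /rot !l2D !singleE; case: eqP => [->|_].
  by rewrite eq_sym (negbTE (gen_neq1 a)) addr0 addrA E.
by case: eqP => [->|_]; rewrite ?addr0// addrA E.
Qed.

Lemma rot_dot a f h : l2dot (rot a f) (rot a h) = l2dot f h.
Proof.
have an1 := negbTE (gen_neq1 a).
have s1 : csummable (fun i => if i == 1%g then 0 else dot H (rot a f i) (rot a h i)).
  exact/csummable_if/l2dot_summable.
have s2 : csummable (fun i => if i == 1%g then 0 else dot H (f i) (h i)).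
  exact/csummable_if/l2dot_summable.
rewrite /l2dot (csum_split 1%g (l2dot_summable _ _)) (csum_split (gen a) s1).
rewrite [RHS](csum_split 1%g (l2dot_summable _ _)) (csum_split (gen a) s2).
rewrite !addrA; congr (_ + _); last first.
  by congr csum; apply/funext => i; rewrite !rotE; case: eqP => // _; case: eqP.
rewrite !rotE an1 !eqxx.
have rc : r%:C%C * r%:C%C + c%:C%C * c%:C%C = 1 :> R[i].
  by rewrite -!rmorphM -rmorphD -!expr2 rc1.
rewrite -!scaleNr -rmorphN.
rewrite !dotDl !dotDr !dotZl !dotZr !conjc_real.
rewrite (_ : (- r)%:C%C = - r%:C%C) ?rmorphN//=.
move: rc; set r' := r%:C%C; set c' := c%:C%C => rc.
set x := dot H (f 1%g) (h 1%g); set y := dot H (f (gen a)) (h (gen a)).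
by rewrite -[RHS]mul1r -rc; ring.
Qed.

Lemma shift_linear a : linear (shift a).
Proof. by move=> k f h; apply: l2P => x; rewrite !(shiftE, l2D, l2Z) linearP. Qed.

Lemma rot_linear a : linear (rot a).
Proof.
move=> k f h; apply: l2P => x; rewrite [RHS]l2D [X in _ = X + _]l2Z !rotE.
case: eqP => _; last case: eqP => _.
- by rewrite !l2D !l2Z !scalerDr !scalerA ![k * _]mulrC addrACA.
- by rewrite !l2D !l2Z !scalerDr !scalerN !scalerA ![k * _]mulrC opprD addrACA.
- by rewrite l2D l2Z.
Qed.

(** Translation by the letter a maps the edge from a^-1 to 1 onto the edge from 1
    to a, and this is the only edge whose orientation away from 1 it reverses.
    The rotation repairs the reversed edge. *)
Definition letter_op a (f : l2) : l2 := rot a (shift a f).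

Lemma letter_opE a f x : letter_op a f x =
  if x == 1%g then c%:C%C *: u (gen a) (f (gen a)^-1%g) + r%:C%C *: u (gen a) (f 1%g)
  else if x == gen a
    then c%:C%C *: u (gen a) (f 1%g) - r%:C%C *: u (gen a) (f (gen a)^-1%g)
    else u (gen a) (f ((gen a)^-1 * x)%g).
Proof. by rewrite /letter_op rotE !shiftE mulg1 mulVg. Qed.

Lemma letter_op_linear a : linear (letter_op a).
Proof. by move=> k f h; rewrite /letter_op shift_linear rot_linear. Qed.
HB.instance Definition _ a := GRing.isLinear.Build R[i] l2 l2 _ (letter_op a) (letter_op_linear a).

Lemma letter_op_dot a f h : l2dot (letter_op a f) (letter_op a h) = l2dot f h.
Proof. by rewrite rot_dot shift_dot. Qed.

(** The plane rotated by the letter a is moved by the translation by a^-1 to the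
    plane rotated by a^-1, where the second rotation undoes the first.  This is
    the only relation needed to pass from letters to the free group. *)
Lemma letter_opK a f : letter_op (letter_inv a) (letter_op a f) = f.
Proof.
have rc : r%:C%C * r%:C%C + c%:C%C * c%:C%C = 1 :> R[i].
  by rewrite -!rmorphM -rmorphD -!expr2 rc1.
have rc' : c%:C%C * c%:C%C + r%:C%C * r%:C%C = 1 :> R[i] by rewrite addrC.
have lin k l (x y : H) :
    u (gen a)^-1%g (k *: u (gen a) x + l *: u (gen a) y) = k *: x + l *: y.
  by rewrite linearP linearZ/= !urepKV.
have E1 (x y : H) : c%:C%C *: (c%:C%C *: x - r%:C%C *: y) +
    r%:C%C *: (c%:C%C *: y + r%:C%C *: x) = x.
  rewrite !scalerDr scalerN !scalerA [r%:C%C * c%:C%C]mulrC addrA subrK.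
  by rewrite -scalerDl rc' scale1r.
have E2 (x y : H) : c%:C%C *: (c%:C%C *: y + r%:C%C *: x) -
    r%:C%C *: (c%:C%C *: x - r%:C%C *: y) = y.
  rewrite !scalerDr scalerN !scalerA [r%:C%C * c%:C%C]mulrC opprB.
  by rewrite addrACA subrr addr0 -scalerDl rc' scale1r.
apply: l2P => x; rewrite letter_opE -genV !invgK.
have V1 : ((gen a)^-1 != 1)%g by rewrite genV.
case: eqP => [->|/eqP x1]; last case: eqP => [->|/eqP xa].
- rewrite !letter_opE eqxx (negbTE (gen_neq1 a)) eqxx -!scaleNr !lin.
  by rewrite scaleNr E1.
- rewrite !letter_opE eqxx (negbTE (gen_neq1 a)) eqxx -!scaleNr !lin.
  by rewrite !scaleNr E2.
- rewrite letter_opE.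
  have -> : (gen a * x == 1)%g = false.
    apply: contra_neqF xa => /eqP h; by rewrite -[x]mul1g -(mulVg (gen a)) -mulgA h mulg1.
  have -> : (gen a * x == gen a)%g = false.
    apply: contra_neqF x1 => /eqP h; by rewrite -[x]mul1g -(mulVg (gen a)) -mulgA h.
  by rewrite mulgA mulVg mul1g urepKV.
Qed.

Definition word_op (w : seq (letter d)) (f : l2) : l2 := foldr letter_op f w.

Lemma word_op_linear w : linear (word_op w).
Proof. by move=> k f h; elim: w => //= a w ->; rewrite linearP. Qed.

Lemma word_op_push a w f : word_op (push a w) f = letter_op a (word_op w f).
Proof.
case: w => [//|b w] /=; case: eqP => [->|//].
by rewrite -{1}[a]letter_invK letter_opK.
Qed.

Lemma word_opM v w f : word_op (foldr (@push d) w v) f = word_op v (word_op w f).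
Proof. by elim: v => //= a v <-; rewrite word_op_push. Qed.

Lemma word_op_dot w f h : l2dot (word_op w f) (word_op w h) = l2dot f h.
Proof. by elim: w => //= a w <-; rewrite letter_op_dot. Qed.

(** The tensor product of u with the deformed regular representation. *)
Definition haagerup_op (g : G) (f : l2_hilbert G H) : l2_hilbert G H := word_op (word g) f.

Lemma haagerup_op_linear g : linear (haagerup_op g).
Proof. exact: word_op_linear. Qed.
HB.instance Definition _ g := GRing.isLinear.Build R[i] (l2_hilbert G H) (l2_hilbert G H) _
  (haagerup_op g) (haagerup_op_linear g).

Lemma haagerup_op1 f : haagerup_op 1%g f = f. Proof. by []. Qed.
Lemma haagerup_opM g h f : haagerup_op (g * h)%g f = haagerup_op g (haagerup_op h f).
Proof. exact: word_opM. Qed.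
Lemma haagerup_op_dot g x y :
  dot (l2_hilbert G H) (haagerup_op g x) (haagerup_op g y) = dot (l2_hilbert G H) x y.
Proof. exact: word_op_dot. Qed.

Definition haagerup : unitary_rep G (l2_hilbert G H) :=
  @UnitaryRep _ _ (l2_hilbert G H) (fun g => haagerup_op g : {linear _ -> _}) haagerup_op1 haagerup_opM haagerup_op_dot.

(** The value at y of the vector attached to the vertex x of the Cayley tree: it
    is carried by the geodesic from 1 to x, whose vertices are the prefixes of x,
    and decays geometrically away from x.  The factors are such that two such
    vectors, at x and x', have inner product r to the power of their distance. *)
Definition ray (x y : seq (letter d)) : R :=
  if prefix y x then (if y is [::] then 1 else c) * r ^+ (size x - size y) else 0.

(** The point mass at 1 is the vector attached to the vertex 1, and the action
    permutes the vectors attached to the vertices.  Only reduced words are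
    followed, so the letter prepended never cancels. *)
Lemma haagerup_single g xi y :
  (haagerup g (single 1%g xi) : l2) y = (ray g y)%:C%C *: u g xi.
Proof.
case: g => w; elim: w y => [|a w IH] y rw.
  rewrite [haagerup _ _]/= singleE /ray prefixs0.
  have -> : FreeGroup rw = 1%g by apply: val_inj.
  rewrite urep1; case: eqP => [->|y1]; first by rewrite mulr1 scale1r.
  case: eqP => [y0|]; last by rewrite scale0r.
  by case: y1; apply: val_inj.
have rw' : reduced w by exact: path_sorted rw.
have gE : FreeGroup rw = (gen a * FreeGroup rw')%g.
  apply: val_inj => /=; case: w rw {IH rw'} => //= b w /andP[/negbTE-> _] //.
rewrite [haagerup _ _]/= /haagerup_op /= letter_opE gE urepM.
have {}IH y' : word_op w (single 1%g xi) y' = (ray w y')%:C%C *: u (FreeGroup rw') xi.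
  exact: (IH y' rw').
rewrite !IH !linearZ /= !scalerA -?scalerDl -?scalerBl.
have npre z : ray w (letter_inv a :: z) = 0.
  rewrite /ray; case: w rw {IH rw' gE} => //= b w /andP[ba _].
  by rewrite eq_sym (negbTE ba).
have ray0 x : ray x [::] = r ^+ size x by rewrite /ray prefix0s mul1r subn0.
rewrite [rev _]/= npre ray0; case: eqP => [->|y1].
  by rewrite mul0r add0r ray0 exprS rmorphM mulrC.
case: eqP => [->|ya].
  rewrite mulr0 scale0r addr0 /ray /= eqxx prefix0s /= subSS subn0 rmorphM.
  by rewrite mulrC.
congr (_%:C%C *: _); case: y y1 ya => -[|b z] ry y1 ya.
  by case: y1; apply: val_inj.
rewrite [word _]/= /push letter_invK; case: eqP => [ba|/eqP ba].
  case: z ry y1 ya => [|b' z] ry y1 ya; first by case: ya; apply: val_inj; rewrite /= ba.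
  by rewrite /ray ba [RHS]/= eqxx subSS.
by rewrite npre /ray prefix_cons (negbTE ba).
Qed.

(** The tensor of the vector attached to the vertex x with xi; the inverse of u x
    compensates for the action of x on the second factor. *)
Definition ray_vec (x : G) (xi : H) : l2_hilbert G H := haagerup x (single 1%g (u x^-1%g xi)).

Lemma ray_vecE x xi y : (ray_vec x xi : l2) y = (ray x y)%:C%C *: xi.
Proof. by rewrite haagerup_single urepK. Qed.

Lemma haagerup_ray_vec g x xi y :
  (haagerup g (ray_vec x xi) : l2) y = (ray (g * x)%g y)%:C%C *: u g xi.
Proof.
rewrite /ray_vec -[haagerup g (haagerup x _)]haagerup_opM -[haagerup_op (g * x)%g _]/(haagerup (g * x)%g _).
by rewrite haagerup_single urepM urepK.
Qed.

Lemma reduced_belast b w : reduced (rcons w b) -> @reduced d w.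
Proof. by rewrite /reduced; case: w => //= a w; rewrite rcons_path => /andP[]. Qed.

Lemma prefix_of_rcons (s w : seq (letter d)) b :
  prefix s (rcons w b) = (s == rcons w b) || prefix s w.
Proof.
elim: w s => [|a w IH] [|x s]; rewrite ?prefix0s ?orbT//.
  by rewrite [rcons _ _]/= prefix_cons !prefixs0 eqseq_cons orbF.
by rewrite rcons_cons !prefix_cons IH eqseq_cons andb_orr.
Qed.

(** The vector attached to a vertex is a combination of the point mass there and
    of the vector attached to its parent.  When c is nonzero, point masses are
    therefore combinations of vectors on which the action is explicit. *)
Lemma ray_vec_rcons w b (rw : reduced (rcons w b)) xi :
  ray_vec (FreeGroup rw) xi = c%:C%C *: single (FreeGroup rw) xi +
    r%:C%C *: ray_vec (FreeGroup (reduced_belast rw)) xi.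
Proof.
apply: l2P => y; rewrite l2D !l2Z !ray_vecE singleE scalerA -rmorphM /=.
have -> : (if y == FreeGroup rw then xi else 0) =
    (word y == rcons w b)%:R%:C%C *: xi.
  rewrite -val_eqE /=; case: eqP => _; first by rewrite scale1r.
  by rewrite scale0r.
rewrite scalerA -rmorphM -scalerDl -rmorphD; congr (_%:C%C *: _).
rewrite /ray prefix_of_rcons size_rcons.
case: eqP => [->|yn] /=.
  have -> : prefix (rcons w b) w = false.
    by apply/negP => /size_prefix; rewrite size_rcons ltnn.
  by rewrite size_rcons subnn expr0 mulr0 addr0 !mulr1; case: (w).
rewrite mulr0 add0r; case: ifP => [/size_prefix yw|]; last by rewrite mulr0.
by rewrite subSn// exprS mulrCA.
Qed.

(** The base rho may exceed r: this allows r = 0, for which the division by a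
    power of r makes no sense. *)
Lemma ray_le (rho : R) x y : 0 <= r -> r <= rho -> 0 < rho -> rho <= 1 ->
  `|ray x y| <= rho ^+ size x / rho ^+ size y.
Proof.
move=> r0 rr rho0 rho1; rewrite /ray; case: ifP => [/size_prefix yx|_]; last first.
  by rewrite normr0 divr_ge0// exprn_ge0// ltW.
rewrite normrM [X in _ * X]ger0_norm ?exprn_ge0// -[leRHS]mul1r; apply: ler_pM => //.
- by rewrite exprn_ge0.
- case: (y) => [|_ _]; first by rewrite normr1.
  rewrite -(@ler_pXn2r _ 2)// ?nnegrE// expr1n real_normK ?num_real//.
  by rewrite -rc1 lerDr sqr_ge0.
- rewrite -exprB//; last by rewrite unitfE gt_eqF.
  by apply: lerXn2r; rewrite // nnegrE// ltW.
Qed.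

End LetterOperators.

(** * Coefficients in l^p *)

Section LpFunctions.
Context (R : realType) (G : groupType).
Implicit Types (f h : G -> R[i]) (p : \bar R).

Lemma in_lp_fin (s : R) f : in_lp s%:E f <-> summ (fun g => rnorm (f g) `^ s).
Proof.
rewrite summP /in_lp (_ : (fun g => (rnorm (f g) `^ s)%:E) = (fun g => `|rnorm (f g) `^ s|%:E))//.
by apply/funext => g; rewrite (ger0_norm (powR_ge0 _ _)).
Qed.

Lemma in_lp_le p f h (C : R) : (0 <= p)%E -> 0 <= C ->
  (forall g, rnorm (f g) <= C * rnorm (h g)) -> in_lp p h -> in_lp p f.
Proof.
case: p => [s||//] s0 C0 fh; last first.
  by move=> [M hM]; exists (C * M) => g; rewrite (le_trans (fh g))// ler_wpM2l.
move=> /in_lp_fin sh; apply/in_lp_fin; rewrite lee_fin in s0.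
apply: summ_le (summZ (C `^ s) sh) => g.
rewrite (ger0_norm (powR_ge0 _ _)) (ger0_norm (mulr_ge0 (powR_ge0 _ _) (powR_ge0 _ _))).
rewrite -powRM ?cnorm_ge0//; apply: ge0_ler_powR; rewrite ?nnegrE ?cnorm_ge0//.
by rewrite mulr_ge0 ?cnorm_ge0.
Qed.

Lemma in_lpZ p k f : (0 <= p)%E -> in_lp p f -> in_lp p (fun g => k * f g).
Proof.
move=> p0; apply: (in_lp_le p0 (cnorm_ge0 k)) => g.
by rewrite cnormM.
Qed.

(** Compare with twice the larger of the two moduli. *)
Lemma in_lpD p f h : (0 <= p)%E -> in_lp p f -> in_lp p h ->
  in_lp p (fun g => f g + h g).
Proof.
case: p => [s||//] s0; last first.
  by move=> [M fM] [N hN]; exists (M + N) => g; rewrite (le_trans (cnormD _ _))// lerD.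
move=> /in_lp_fin sf /in_lp_fin sh; apply/in_lp_fin; rewrite lee_fin in s0.
apply: summ_le (summD (summZ (2 `^ s) sf) (summZ (2 `^ s) sh)) => g.
rewrite (ger0_norm (powR_ge0 _ _)) (ger0_norm (addr_ge0 (mulr_ge0 (powR_ge0 _ _) (powR_ge0 _ _)) (mulr_ge0 (powR_ge0 _ _) (powR_ge0 _ _)))).
rewrite -!powRM ?cnorm_ge0//.
wlog fh : f h {sf sh} / rnorm (f g) <= rnorm (h g) => [H|].
  by have [/H//|/ltW/H] := leP (rnorm (f g)) (rnorm (h g)); rewrite addrC [leRHS]addrC.
apply: le_trans (_ : (2 * rnorm (h g)) `^ s <= _); last by rewrite lerDr powR_ge0.
apply: ge0_ler_powR; rewrite ?nnegrE ?cnorm_ge0 ?(mulr_ge0 (ler0n _ 2) (cnorm_ge0 _))//.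
by rewrite (le_trans (cnormD _ _))// mulr2n mulrDl mul1r lerD.
Qed.

Lemma in_lp0 p : (2%:E <= p)%E -> in_lp p (fun _ : G => 0 : R[i]).
Proof.
have n0 : rnorm (0 : R[i]) = 0 by rewrite normr0.
case: p => [s||//] s0; last by exists 0 => g; rewrite n0.
apply/in_lp_fin; exists 0 => J; rewrite big1// => g _.
rewrite n0 powR0 ?normr0// gt_eqF//; move: s0; rewrite lee_fin; exact: lt_le_trans.
Qed.

Lemma in_lp_sum p (T : Type) (s : seq T) (F : T -> G -> R[i]) : (2%:E <= p)%E ->
  (forall t, in_lp p (F t)) -> in_lp p (fun g => \sum_(t <- s) F t g).
Proof.
move=> p2 Fp; have p0 : (0 <= p)%E by apply: le_trans p2; rewrite lee_fin.
elim: s => [|t s IH].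
  by under [X in in_lp _ X]eq_fun do rewrite big_nil; exact: in_lp0.
by under [X in in_lp _ X]eq_fun do rewrite big_cons; exact: in_lpD.
Qed.

(** A function in l^s is bounded by some B, and |f|^t <= B^(t-s) |f|^s. *)
Lemma in_lp_mono p q f : (2%:E <= p)%E -> (p <= q)%E -> in_lp p f -> in_lp q f.
Proof.
case: p => [s||//]; last by move=> _; rewrite leye_eq => /eqP->.
rewrite lee_fin => s2; have s0 : 0 < s by apply: lt_le_trans s2.
move=> + /in_lp_fin[M fM].
have M0 : 0 <= M by have := fM fset0; rewrite big_seq_fset0.
have fb g : rnorm (f g) `^ s <= M.
  have := fM [fset g]%fset; rewrite big_seq_fset1; apply: le_trans.
  exact: ler_norm.
have fb' g : rnorm (f g) <= M `^ s^-1.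
  have := fb g; move=> /(ge0_ler_powR (r := s^-1)).
  rewrite -powRrM mulfV ?gt_eqF// powRr1 ?cnorm_ge0//; apply.
  - by rewrite invr_ge0 ltW.
  - by rewrite nnegrE powR_ge0.
  - by rewrite nnegrE.
case: q => [t||//] st; last by exists (M `^ s^-1).
rewrite lee_fin in st; apply/in_lp_fin.
have h : summ (fun g => (M `^ s^-1) `^ (t - s) * rnorm (f g) `^ s).
  by apply: summZ; exists M.
apply: summ_le h => g; rewrite (ger0_norm (powR_ge0 _ _)) (ger0_norm (mulr_ge0 (powR_ge0 _ _) (powR_ge0 _ _))).
rewrite -{1}(subrK s t) powRD; last first.
  by apply/implyP => /eqP h; rewrite subrK in h; move: st; rewrite h leNgt s0.
by apply: ler_wpM2r; rewrite ?powR_ge0//; apply: ge0_ler_powR;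
  rewrite ?subr_ge0 ?nnegrE ?cnorm_ge0 ?powR_ge0.
Qed.

End LpFunctions.

Section TensorLp.
Context (R : realType) (d : nat) (H : hilbertSpace R)
        (u : unitary_rep (free_group d) H).
Context (r c : R) (rc1 : r ^+ 2 + c ^+ 2 = 1).
Local Notation G := (free_group d).

Lemma size_mulg (g x : G) : (size (g * x)%g <= size g + size x)%N.
Proof.
suff E (v w : seq (letter d)) : (size (foldr (@push d) w v) <= size v + size w)%N by exact: E.
elim: v => //= a v IH; apply: (@leq_trans (size (foldr (@push d) w v)).+1); last first.
  by rewrite addSn ltnS.
by case: (foldr _ _ _) => //= b w'; case: ifP => //= _; exact: leqW.
Qed.

Lemma size_invg (x : G) : size (x^-1)%g = size x.
Proof. by rewrite /= size_rev size_map. Qed.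

(** The dense subspace consists of the finitely supported functions with values
    in a dense subspace K given by u.  By linearity it is enough to look at point
    masses, and then at the vectors [ray_vec]: up to a constant, the coefficient
    at g is at most rho^|g| times a coefficient of u, because |g x| >= |g| - |x|. *)
Lemma haagerup_lp (p q : \bar R) (rho : R) : (2%:E <= p)%E -> lp_rep q u ->
  0 <= r -> r <= rho -> 0 < rho -> rho <= 1 -> c != 0 ->
  (forall f, in_lp q f -> in_lp p (fun g : G => (rho ^+ size g)%:C%C * f g)) ->
  lp_rep p (haagerup u rc1).
Proof.
move=> p2 [K [Ks Kd Kq]] r0 rr rho0 rho1 c0 tr.
have p0 : (0 <= p)%E by apply: le_trans p2; rewrite lee_fin.
exists (finsupp_in K); split; [exact: finsupp_in_subspace|exact: finsupp_in_dense|].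
have Lvec x y xi eta : K xi -> K eta ->
    in_lp p (fun g => dot (l2_hilbert G H) (haagerup u rc1 g (ray_vec u rc1 x xi)) (single y eta)).
  move=> Kxi Keta.
  pose C := (rho ^+ size x * rho ^+ size y)^-1.
  have C0 : 0 <= C by rewrite invr_ge0 mulr_ge0// exprn_ge0// ltW.
  apply: (in_lp_le p0 C0) (tr _ (Kq _ _ Kxi Keta)) => g.
  rewrite dot_single haagerup_ray_vec dotZl !cnormM mulrA ler_wpM2r ?cnorm_ge0//.
  rewrite !cnorm_real (le_trans (ray_le rc1 _ _ r0 rr rho0 rho1))//.
  rewrite (ger0_norm (exprn_ge0 _ (ltW rho0))) /C invfM.
  rewrite mulrAC; apply: ler_wpM2r; first by rewrite invr_ge0 exprn_ge0// ltW.
  rewrite ler_pdivlMl ?exprn_gt0// -exprD; apply: ler_wiXn2l; rewrite ?(ltW rho0)//.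
  rewrite -{1}[g]mulg1 -(mulgV x) mulgA addnC -(size_invg x).
  exact: size_mulg.
have Lsingle x y xi eta : K xi -> K eta ->
    in_lp p (fun g => dot (l2_hilbert G H) (haagerup u rc1 g (single x xi)) (single y eta)).
  move=> Kxi Keta; case: x => w; case/lastP: w => [|w b] rw.
    have -> : FreeGroup rw = 1%g by apply: val_inj.
    have V1 : ray_vec u rc1 1%g xi = single 1%g xi by rewrite /ray_vec invg1 !urep1.
    by have := Lvec 1%g y _ _ Kxi Keta; rewrite V1.
  have E : single (FreeGroup rw) xi =
      c%:C%C^-1 *: ray_vec u rc1 (FreeGroup rw) xi +
      (- (c%:C%C^-1 * r%:C%C)) *: ray_vec u rc1 (FreeGroup (reduced_belast rw)) xi :> l2_hilbert G H.
    rewrite ray_vec_rcons scalerDr !scalerA mulVf; last by rewrite eq_complex/= (negbTE c0).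
    by rewrite scale1r scaleNr addrK.
  under [X in in_lp _ X]eq_fun do rewrite E linearD !linearZ dotDl !dotZl.
  by apply: in_lpD => //; apply: in_lpZ => //; exact: Lvec.
move=> f h [Kf [J fJ]] [Kh [J' hJ']].
rewrite (restr_supp fJ) (restr_supp hJ') /restr.
under [X in in_lp _ X]eq_fun do rewrite dot_sumr.
apply: in_lp_sum => // y.
under [X in in_lp _ X]eq_fun do rewrite (linear_sum (haagerup u rc1 _)) dot_suml.
by apply: in_lp_sum => // x; exact: Lsingle.
Qed.

End TensorLp.

(** * Growth of the free group *)

Section Growth.
Context (R : realType) (d : nat).
Local Notation G := (free_group d).

Lemma count_words (J : {fset G}) n :
  (count (fun g : G => size g == n) J <= (d * 2) ^ n)%N.
Proof.
have -> : ((d * 2) ^ n = size (map val (enum {: n.-tuple ('I_d * bool)})))%N.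
  by rewrite size_map -cardE card_tuple card_prod card_ord card_bool.
rewrite -size_filter -(size_map (@word d)); apply: uniq_leq_size.
  by rewrite map_inj_uniq ?filter_uniq ?fset_uniq//; exact: val_inj.
move=> w /mapP[g]; rewrite mem_filter => /andP[gn _] ->.
by apply/mapP; exists (Tuple gn); rewrite ?mem_enum.
Qed.

(** Group the words by length; those of length n contribute at most
    (2 d t)^n <= 2^-n, and the geometric series sums to 2. *)
Lemma summ_growth (t : R) : 0 <= t -> (d * 2)%:R * t <= 2^-1 ->
  summ (fun g : G => t ^+ size g).
Proof.
move=> t0 dt; exists 2 => J.
under eq_bigr do rewrite ger0_norm ?exprn_ge0//.
pose N := (\max_(g <- J) (size (word g))).+1.
have -> : \sum_(g <- J) t ^+ size g =
    \sum_(n < N) \sum_(g <- J | size g == n) t ^+ n.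
  rewrite (exchange_big_dep predT)//= big_seq [RHS]big_seq; apply: eq_bigr => g gJ.
  have gN : (size g < N)%N by rewrite ltnS; apply: leq_bigmax_seq.
  by rewrite (big_pred1 (Ordinal gN))// => i; rewrite -val_eqE eq_sym.
apply: (@le_trans _ _ (\sum_(n < N) (2^-1 : R) ^+ n)).
  apply: ler_sum => n _; rewrite big_const_seq iter_addr_0 -[leLHS]mulr_natl.
  apply: le_trans (_ : ((d * 2) ^ n)%:R * t ^+ n <= _).
    by rewrite ler_wpM2r ?exprn_ge0// ler_nat count_words.
  rewrite natrX -exprMn lerXn2r// ?nnegrE ?invr_ge0//.
  by rewrite mulr_ge0.
have -> : \sum_(n < N) (2^-1 : R) ^+ n = 2 * (1 - 2^-1 ^+ N).
  have := subrXX 1 (2^-1 : R) N; rewrite expr1n => ->.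
  rewrite mulrA (_ : 2 * (1 - 2^-1) = 1 :> R); last by field.
  by rewrite mul1r; apply: eq_bigr => i _; rewrite expr1n mul1r.
by rewrite -[leRHS]mulr1 ler_pM2l// gerBl exprn_ge0// invr_ge0.
Qed.

(** This says that p <= q and that the exponent h with 1/h = 1/p - 1/q is at
    least N; denominators are cleared, and p = q is the case of an infinite h. *)
Definition close_exponents (p q : \bar R) (N : nat) : Prop :=
  match p, q with
  | s%:E, t%:E => s <= t /\ (t - s) * N%:R <= s * t
  | s%:E, +oo%E => N%:R <= s
  | +oo%E, +oo%E => True
  | _, _ => False
  end.

(** Hoelder's inequality for the exponents t/s and t/(t-s), in a crude pointwise
    form: with b = rho^k, either b^s <= a^(t-s), and then (b a)^s <= a^t, or a is
    small and (b a)^s is at most b^(s t/(t-s)), where s t/(t-s) >= N. *)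
Lemma holder_pointwise (s t rho a : R) (k N : nat) : 0 < s -> s <= t ->
  (t - s) * N%:R <= s * t -> 0 < rho -> rho <= 1 -> 0 <= a ->
  (rho ^+ k * a) `^ s <= a `^ t + (rho ^+ N) ^+ k.
Proof.
move=> s0 st NN rho0 rho1 a0.
have rk0 : 0 <= rho ^+ k by rewrite exprn_ge0// ltW.
have rN0 : 0 <= (rho ^+ N) ^+ k by rewrite !exprn_ge0// ltW.
rewrite powRM//.
have rkE : (rho ^+ k) `^ s = rho `^ (k%:R * s) by rewrite powRrM powR_mulrn// ltW.
have [ts|ts] := leP t s.
  have -> : t = s by apply/eqP; rewrite eq_le ts st.
  rewrite (le_trans _ (_ : a `^ s <= _)) ?lerDl//.
  rewrite -[leRHS]mul1r ler_wpM2r ?powR_ge0//.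
  have -> : 1 = 1 `^ s :> R by rewrite powR1.
  by apply: ge0_ler_powR; rewrite ?nnegrE ?ler01 ?(ltW s0)// exprn_ile1// ltW.
have ts0 : 0 < t - s by rewrite subr_gt0.
have [h|h] := leP ((rho ^+ k) `^ s) (a `^ (t - s)).
  rewrite (le_trans _ (_ : a `^ t <= _)) ?lerDl//.
  rewrite -[t in leRHS](subrK s) powRD; last by apply/implyP; rewrite subrK gt_eqF// (lt_trans s0).
  by rewrite ler_wpM2r ?powR_ge0.
rewrite (le_trans _ (_ : (rho ^+ N) ^+ k <= _)) ?lerDr ?powR_ge0//.
have tsn0 : t - s != 0 by rewrite gt_eqF.
have a_le : a `^ s <= rho `^ (k%:R * s * (s / (t - s))).
  have -> : a `^ s = (a `^ (t - s)) `^ (s / (t - s)) by rewrite -powRrM mulrC divfK.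
  rewrite [leRHS]powRrM -rkE.
  apply: ge0_ler_powR; rewrite ?nnegrE ?powR_ge0//; last exact: ltW.
  by rewrite divr_ge0 ?ltW.
apply: le_trans (ler_wpM2l (powR_ge0 _ _) a_le) _.
rewrite rkE -powRD; last by rewrite (gt_eqF rho0) implybT.
rewrite -exprM -[leRHS]powR_mulrn ?(ltW rho0)//; apply: ger_powR; first by rewrite rho0.
rewrite natrM -subr_ge0.
have -> : k%:R * s + k%:R * s * (s / (t - s)) - N%:R * k%:R =
    k%:R * ((s * t - (t - s) * N%:R) / (t - s)) by field.
by rewrite mulr_ge0// divr_ge0 ?subr_ge0// ltW.
Qed.

Lemma in_lp_transfer (p q : \bar R) (N : nat) (rho : R) : (2%:E <= p)%E ->
  close_exponents p q N -> 0 < rho -> rho <= 1 -> (d * 2)%:R * rho ^+ N <= 2^-1 ->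
  forall f : G -> R[i], in_lp q f ->
  in_lp p (fun g : G => (rho ^+ size g)%:C%C * f g).
Proof.
move=> p2 pq rho0 rho1 dN f.
have rk0 k : 0 <= rho ^+ k by rewrite exprn_ge0// ltW.
have sg := summ_growth (rk0 N) dN.
case: p q p2 pq => [s| |] [t| |]//; last first.
  move=> _ _ [M fM]; exists M => g; apply: le_trans (fM g).
  rewrite cnormM cnorm_real ger0_norm// -[leRHS]mul1r ler_wpM2r ?cnorm_ge0//.
  by rewrite exprn_ile1// ltW.
- rewrite lee_fin => s2 Ns [M fM]; apply/in_lp_fin.
  have M0 : 0 <= M by apply: le_trans (fM 1%g); exact: cnorm_ge0.
  apply: summ_le (summZ (M `^ s) sg) => g.
  rewrite (ger0_norm (powR_ge0 _ _)) (ger0_norm (mulr_ge0 (powR_ge0 _ _) (exprn_ge0 _ (rk0 N)))).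
  rewrite cnormM cnorm_real ger0_norm// powRM ?cnorm_ge0// mulrC.
  have s0 : 0 <= s by apply: le_trans s2.
  apply: ler_pM; rewrite ?powR_ge0//.
    by apply: ge0_ler_powR; rewrite ?nnegrE ?cnorm_ge0.
  rewrite -exprM mulnC exprM -[leRHS]powR_mulrn//.
  by apply: ger_powR; rewrite ?exprn_gt0 ?exprn_ile1 ?(ltW rho0)//.
- rewrite lee_fin => s2 [st NN] /in_lp_fin sf; apply/in_lp_fin.
  apply: summ_le (summD sf sg) => g.
  rewrite (ger0_norm (powR_ge0 _ _)) (ger0_norm (addr_ge0 (powR_ge0 _ _) (exprn_ge0 _ (rk0 N)))).
  rewrite cnormM cnorm_real ger0_norm//; apply: holder_pointwise => //.
    by apply: lt_le_trans s2.
  exact: cnorm_ge0.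
Qed.

End Growth.

(** * The contraction estimate *)

Section Vnorm.
Context (R : realType) (H : hilbertSpace R) (n : nat).
Implicit Types x y : 'I_n -> H.

Lemma fset_sum_le (J : {fset 'I_n}) (F : 'I_n -> R) : (forall i, 0 <= F i) ->
  \sum_(i <- J) F i <= \sum_i F i.
Proof.
move=> F0; rewrite big_uniq ?fset_uniq// [leLHS]big_mkcond.
by apply: ler_sum => i _; case: ifP.
Qed.

Lemma tuple_l2_subproof x : x \in @l2_pred R 'I_n H.
Proof.
apply/l2_predP; exists (\sum_i rnorm (x i) ^+ 2) => J.
under eq_bigr do rewrite ger0_norm ?sqr_ge0//.
by apply: fset_sum_le => i; exact: sqr_ge0.
Qed.

(** The norm of a column of vectors is an l^2 norm over a finite index set, which
    provides the triangle inequality for [vnorm]. *)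
Definition tuple_l2 x : l2 'I_n H := L2 (tuple_l2_subproof x).

Lemma vnormE x : vnorm x = l2nm (tuple_l2 x).
Proof.
congr Num.sqrt; apply/eqP; rewrite eq_le; apply/andP; split; last first.
  by apply: nsum_le => [i|J]; [exact: sqr_ge0|apply: fset_sum_le => i; exact: sqr_ge0].
have E : \sum_(i <- [fset i | i in 'I_n]%fset) rnorm (x i) ^+ 2 = \sum_i rnorm (x i) ^+ 2.
  by rewrite big_uniq ?fset_uniq//; apply: eq_bigl => i; rewrite in_fset.
by rewrite -E; exact: (l2sq_ge (tuple_l2 x)).
Qed.

Lemma vnorm_ge0 x : 0 <= vnorm x. Proof. exact: sqrtr_ge0. Qed.

Lemma vnormD x y : vnorm (fun i => x i + y i) <= vnorm x + vnorm y.
Proof.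
rewrite !vnormE (_ : tuple_l2 _ = tuple_l2 x + tuple_l2 y) ?l2nmD//.
exact: l2P.
Qed.

Lemma vnormZ (k : R[i]) x : vnorm (fun i => k *: x i) = rnorm k * vnorm x.
Proof. by rewrite !vnormE -l2nmZ; congr l2nm; apply: l2P. Qed.

Lemma vnorm0 : vnorm (fun _ : 'I_n => 0 : H) = 0.
Proof. by rewrite /vnorm big1 ?sqrtr0// => i _; rewrite rnorm0 expr0n. Qed.

Lemma vnorm_sum (T : Type) (s : seq T) (F : T -> 'I_n -> H) :
  vnorm (fun i => \sum_(t <- s) F t i) <= \sum_(t <- s) vnorm (F t).
Proof.
elim: s => [|t s IH].
  by under eq_fun do rewrite big_nil; rewrite big_nil vnorm0.
under eq_fun do rewrite big_cons; rewrite big_cons.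
exact: le_trans (vnormD _ _) (lerD (lexx _) IH).
Qed.

End Vnorm.

Lemma le_vnorm (R : realType) (H K : hilbertSpace R) n (x : 'I_n -> H) (y : 'I_n -> K) :
  (forall i, rnorm (x i) <= rnorm (y i)) -> vnorm x <= vnorm y.
Proof.
move=> xy; rewrite /vnorm ler_sqrt ?sumr_ge0// => [|i _]; last exact: sqr_ge0.
by apply: ler_sum => i _; rewrite ler_sqr ?nnegrE ?rnorm_ge0.
Qed.

Section Coefficients.
Context (R : realType) (d : nat).
Local Notation G := (free_group d).
Local Notation A := (group_algebra R G).

Definition supported (S : {fset G}) n (a : 'M[A]_n) : Prop :=
  forall i j, (msupp (a i j) `<=` S)%fset.

Lemma alg_rep_supp (S : {fset G}) (H : hilbertSpace R) (u : unitary_rep G H) (a : A) x :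
  (msupp a `<=` S)%fset -> alg_rep u a x = \sum_(g <- S) mcoeff g a *: u g x.
Proof.
move=> aS; apply: big_fset_incl => // g _ /mcoeff_outdom ->.
by rewrite scale0r.
Qed.

Definition coef_op (H : hilbertSpace R) n (a : 'M[A]_n) (g : G) (x : 'I_n -> H) : 'I_n -> H :=
  fun i => \sum_j mcoeff g (a i j) *: x j.

Lemma amp_rep_coef S (H : hilbertSpace R) (u : unitary_rep G H) n (a : 'M[A]_n) x :
  supported S a ->
  amp_rep u a x = fun i => \sum_(g <- S) coef_op a g (fun j => u g (x j)) i.
Proof.
move=> aS; apply/funext => i; rewrite exchange_big /=.
by apply: eq_bigr => j _; exact: alg_rep_supp.
Qed.

Lemma amp_rep_haagerup S (H : hilbertSpace R) (u : unitary_rep G H) (r c : R)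
    (rc1 : r ^+ 2 + c ^+ 2 = 1) n (a : 'M[A]_n) (x : 'I_n -> H) i h :
  supported S a ->
  (amp_rep (haagerup u rc1) a (fun j => single 1%g (x j)) i : l2 G H) h =
  \sum_(g <- S) (ray r c g h)%:C%C *: coef_op a g (fun j => u g (x j)) i.
Proof.
move=> aS; rewrite (amp_rep_coef _ _ aS) l2_sum; apply: eq_bigr => g _.
rewrite l2_sum scaler_sumr; apply: eq_bigr => j _.
by rewrite l2Z haagerup_single !scalerA mulrC.
Qed.

Lemma vnorm_amp_le (p : \bar R) (H : hilbertSpace R) (u : unitary_rep G H) n
   (a : 'M[A]_n) (M : R) (x : 'I_n -> H) : lp_rep p u -> (lp_mxnorm p a <= M%:E)%E ->
  vnorm x <= 1 -> vnorm (amp_rep u a x) <= M.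
Proof.
move=> up aM x1; rewrite -lee_fin; apply: le_trans aM.
apply: (@le_trans _ _ (amp_norm u a)); last first.
  by apply: ereal_sup_ubound; exists H, u.
by apply: ereal_sup_ubound; exists x.
Qed.

(** Apply the matrix a, in the representation [haagerup u], to the column of point
    masses at 1 with values x, and evaluate the result at the vertex h. *)
Lemma vnorm_haagerup_le (p : \bar R) (H : hilbertSpace R) (u : unitary_rep G H) (r c : R)
    (rc1 : r ^+ 2 + c ^+ 2 = 1) n (a : 'M[A]_n) (M : R) (x : 'I_n -> H) S (h : G) :
  supported S a -> lp_rep p (haagerup u rc1) -> (lp_mxnorm p a <= M%:E)%E ->
  vnorm x <= 1 ->
  vnorm (fun i => \sum_(g <- S) (ray r c g h)%:C%C *: coef_op a g (fun j => u g (x j)) i) <= M.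
Proof.
move=> aS Tp aM x1.
apply: le_trans (vnorm_amp_le (x := fun j => single 1%g (x j) : l2_hilbert G H) Tp aM _).
  by apply: le_vnorm => i; rewrite -(amp_rep_haagerup u rc1 x i h aS); exact: coord_le_l2nm.
apply: le_trans x1; apply: le_vnorm => i.
by rewrite [leLHS]l2nm_single.
Qed.

(** The identity, as a function of g as well: it is the value of the trivial
    representation, whose deformation for r = 0 is a multiple of the regular
    representation. *)
Definition triv_fun (H : hilbertSpace R) (g : G) (x : H) : H := x.
Lemma triv_linear H g : linear (@triv_fun H g). Proof. by []. Qed.
HB.instance Definition _ (H : hilbertSpace R) (g : G) := GRing.isLinear.Build R[i] H H _ (@triv_fun H g) (triv_linear g).

Definition triv H : unitary_rep G H :=
  @UnitaryRep R G H (fun g => @triv_fun H g : {linear H -> H})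
    (fun=> erefl) (fun _ _ _ => erefl) (fun _ _ _ => erefl).

Lemma triv_lp H : lp_rep +oo (triv H).
Proof.
exists setT; split => //; first by move=> O O0 _; rewrite setIT.
by move=> x y _ _; exists (rnorm (dot H x y)).
Qed.

Lemma regular_rc1 : (0 : R) ^+ 2 + 1 ^+ 2 = 1.
Proof. by rewrite expr0n expr1n add0r. Qed.

Definition regular H := haagerup (triv H) regular_rc1.

(** The coefficients of the trivial representation are bounded, so it is enough
    that rho^|g| be in l^2 for some rho > 0; rho = 1/(4d) will do. *)
Lemma regular_lp (p : \bar R) H : (2%:E <= p)%E -> (0 < d)%N -> lp_rep p (regular H).
Proof.
move=> p2 d0; pose rho : R := (d * 4)%:R^-1.
have d40 : (0 : R) < (d * 4)%:R by rewrite ltr0n muln_gt0 d0.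
have rho0 : 0 < rho by rewrite invr_gt0.
have rho1 : rho <= 1 by rewrite invf_le1// ler1n muln_gt0 d0.
apply: (haagerup_lp (rho := rho) regular_rc1 p2 (triv_lp H)) => //; first exact: ltW.
apply: (in_lp_transfer (N := 2)) => //.
  by case: p p2 => [s||]//=; rewrite lee_fin.
have -> : (d * 2)%:R * rho ^+ 2 = 2^-1 * rho.
  rewrite /rho !natrM; field; by rewrite pnatr_eq0 -lt0n.
by rewrite -[leRHS]mulr1 ler_pM2l// invr_gt0.
Qed.

Lemma ray_regular (g h : seq (letter d)) : ray 0 1 g h = (g == h)%:R :> R.
Proof.
rewrite /ray; case: eqP => [->|gh].
  by rewrite prefix_refl subnn expr0 mulr1; case: h.
case: ifP => // /prefixP[k gE]; move: gh; rewrite gE size_cat addKn.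
case: k {gE} => [|b k] gh; first by case: gh; rewrite cats0.
by rewrite expr0n mulr0.
Qed.

(** In the regular representation the group elements move the point mass at 1 to
    disjoint places, so the coefficient at g is read off at the vertex g. *)
Lemma coef_op_le (p : \bar R) (H : hilbertSpace R) n (a : 'M[A]_n) (M : R) g (x : 'I_n -> H) :
  (2%:E <= p)%E -> (0 < d)%N -> (lp_mxnorm p a <= M%:E)%E -> vnorm x <= 1 ->
  vnorm (coef_op a g x) <= M.
Proof.
move=> p2 d0 aM x1.
pose S : {fset G} := (g |` \big[fsetU/fset0]_(ij : 'I_n * 'I_n) msupp (a ij.1 ij.2))%fset.
have aS : supported S a.
  move=> i j; apply: fsubset_trans (fsubsetUr _ _).
  by rewrite (bigD1 (i, j))//= fsubsetUl.
have gS : g \in S by rewrite in_fset1U eqxx.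
have := vnorm_haagerup_le g aS (regular_lp H p2 d0) aM x1.
rewrite (_ : (fun i => _) = coef_op a g x)//; apply/funext => i.
rewrite (bigD1_seq g) ?fset_uniq//= ray_regular eqxx scale1r big1 ?addr0// => h hg.
by rewrite ray_regular val_eqE (negbTE hg) scale0r.
Qed.

(** Split each coefficient as r^|g| + (1 - r^|g|).  The first part is the value at
    the vertex 1 in the representation [haagerup u], which is l^p although u is
    only l^q; the second part is small, coefficient by coefficient. *)
Lemma contraction_bound (p q : \bar R) (N : nat) (r : R) (S : {fset G})
    (H : hilbertSpace R) (u : unitary_rep G H) n (a : 'M[A]_n) (x : 'I_n -> H) :
  (2%:E <= p)%E -> (0 < d)%N -> close_exponents p q N -> 0 < r < 1 ->
  (d * 2)%:R * r ^+ N <= 2^-1 -> lp_rep q u -> supported S a ->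
  (lp_mxnorm p a <= 1%:E)%E -> vnorm x <= 1 ->
  vnorm (amp_rep u a x) <= 1 + \sum_(g <- S) (1 - r ^+ size g).
Proof.
move=> p2 d0 pq /andP[r0 r1] dN uq aS a1 x1.
have r21 : 0 < 1 - r ^+ 2 by rewrite subr_gt0 expr_lt1// ltW.
pose c := Num.sqrt (1 - r ^+ 2).
have rc1 : r ^+ 2 + c ^+ 2 = 1 by rewrite sqr_sqrtr ?ltW// addrC subrK.
have Tp : lp_rep p (haagerup u rc1).
  apply: (haagerup_lp (rho := r) rc1 p2 uq) => //; rewrite ?ltW//.
    by rewrite gt_eqF// sqrtr_gt0.
  by apply: (in_lp_transfer (N := N)) => //; rewrite ltW.
rewrite (amp_rep_coef _ _ aS).
pose y g := coef_op a g (fun j => u g (x j)).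
have -> : (fun i => \sum_(g <- S) y g i) = (fun i =>
    \sum_(g <- S) (ray r c g (1%g : G))%:C%C *: y g i +
    \sum_(g <- S) (1 - r ^+ size g)%:C%C *: y g i).
  apply/funext => i; rewrite -big_split; apply: eq_bigr => g _ /=.
  rewrite /ray prefix0s mul1r subn0 -scalerDl -rmorphD.
  by rewrite addrC subrK scale1r.
apply: le_trans (vnormD _ _) _; apply: lerD.
  exact: (vnorm_haagerup_le 1%g aS Tp a1 x1).
apply: le_trans (vnorm_sum _ _) _; apply: ler_sum => g _.
have rg : 0 <= 1 - r ^+ size g by rewrite subr_ge0 exprn_ile1// ltW.
rewrite vnormZ cnorm_real ger0_norm// -[leRHS]mulr1 ler_wpM2l//.
apply: (coef_op_le g p2 d0 a1); apply: le_trans x1; apply: le_vnorm => j.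
by rewrite urep_rnorm.
Qed.

Lemma lp_mxnorm_mono (p q : \bar R) n (a : 'M[A]_n) :
  (2%:E <= p)%E -> (p <= q)%E -> (lp_mxnorm p a <= lp_mxnorm q a)%E.
Proof.
move=> p2 pq; apply: le_ereal_sup => _ [H [u [[K [Ks Kd Kp]] ->]]].
exists H, u; split=> //; exists K; split=> // x y Kx Ky.
exact: in_lp_mono p2 pq (Kp _ _ Kx Ky).
Qed.

End Coefficients.

(** * Bounds on the distance *)

Section Scalars.
Context (R : realType) (d : nat).
Local Notation G := (free_group d).
Local Notation A := (group_algebra R G).
Implicit Types (p q : \bar R) (y : A).

Lemma ge_lp_mxnorm p n (a : 'M[A]_n) (M : R) :
  (forall (H : hilbertSpace R) (u : unitary_rep G H) x, lp_rep p u ->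
     vnorm x <= 1 -> vnorm (amp_rep u a x) <= M) ->
  (lp_mxnorm p a <= M%:E)%E.
Proof.
move=> aM; apply: ge_ereal_sup => _ [H [u [up ->]]].
by apply: ge_ereal_sup => _ [x x1 <-]; rewrite lee_fin; exact: aM.
Qed.

Lemma lp_mxnorm_ge0 p n (a : 'M[A]_n) : (2%:E <= p)%E -> (0 < d)%N ->
  (0 <= lp_mxnorm p a)%E.
Proof.
move=> p2 d0; have rp := @regular_lp R d p (complex_hilbert R) p2 d0.
apply: (@le_trans _ _ (amp_norm (regular d (complex_hilbert R)) a)); last first.
  by apply: ereal_sup_ubound; exists (l2_hilbert G (complex_hilbert R)), (regular d (complex_hilbert R)).
pose x0 : 'I_n -> l2_hilbert G (complex_hilbert R) := fun=> 0.
apply: (@le_trans _ _ (vnorm (amp_rep (regular d (complex_hilbert R)) a x0))%:E).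
  by rewrite lee_fin vnorm_ge0.
by apply: ereal_sup_ubound; exists x0 => //=; rewrite vnorm0.
Qed.

Let one y : 'M[A]_1 := const_mx y.

Lemma supported1 y : supported (msupp y) (one y).
Proof. by move=> i j; rewrite mxE. Qed.

Lemma coef_op1 (H : hilbertSpace R) y g (x : 'I_1 -> H) :
  coef_op (one y) g x = fun i => mcoeff g y *: x i.
Proof. by apply/funext => i; rewrite /coef_op big_ord1 mxE (ord1 i). Qed.

Lemma lp_mxnorm1_fin p y :
  (lp_mxnorm p (one y) <= (\sum_(g <- msupp y) rnorm (mcoeff g y))%:E)%E.
Proof.
apply: ge_lp_mxnorm => H u x _ x1; rewrite (amp_rep_coef _ _ (supported1 y)).
apply: le_trans (vnorm_sum _ _) _; apply: ler_sum => g _.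
rewrite coef_op1 vnormZ -[leRHS]mulr1 ler_wpM2l ?cnorm_ge0//.
by apply: le_trans x1; apply: le_vnorm => i; rewrite urep_rnorm.
Qed.

Lemma lp_mxnorm1_fin_num p y : (2%:E <= p)%E -> (0 < d)%N ->
  lp_mxnorm p (one y) \is a fin_num.
Proof.
move=> p2 d0; rewrite ge0_fin_numE ?lp_mxnorm_ge0//.
exact: le_lt_trans (lp_mxnorm1_fin p y) (ltry _).
Qed.

(** A nonzero coefficient of y bounds its norm from below, by testing the regular
    representation with coefficients in the complex line. *)
Lemma lp_mxnorm1_gt0 p y : (2%:E <= p)%E -> (0 < d)%N -> y != 0 ->
  exists2 M : R, 0 < M & lp_mxnorm p (one y) = M%:E.
Proof.
move=> p2 d0 y0.
have f := lp_mxnorm1_fin_num y p2 d0; exists (fine (lp_mxnorm p (one y))); last by rewrite fineK.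
have [g gy] : exists g, g \in msupp y.
  apply: contrapT => /forallNP h; case/eqP: y0; apply/malgP => g.
  by rewrite mcoeff0 mcoeff_outdom//; apply/negP/h.
pose x : 'I_1 -> complex_hilbert R := fun=> (1 : R[i]).
have n1 : rnorm (1 : R[i]) = 1 by rewrite normr1.
have x1 : vnorm x = 1.
  by rewrite /vnorm big_ord1 /x [rnorm _]n1 expr1n sqrtr1.
have := @coef_op_le R d p (complex_hilbert R) 1 (one y) (fine (lp_mxnorm p (one y))) g x p2 d0.
rewrite fineK// lexx x1 lexx coef_op1 vnormZ x1 mulr1 => /(_ isT isT).
apply: lt_le_trans; rewrite lt_def cnorm_ge0 andbT.
apply/eqP => h; move: gy; rewrite -mcoeff_neq0 => /eqP; apply.
by apply/eqP; rewrite -normr_eq0 cnormE h.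
Qed.

Lemma lp_mxnorm1Z_le p (k : R[i]) y (M : R) :
  (lp_mxnorm p (one y) <= M%:E)%E -> (lp_mxnorm p (one (k *: y)) <= (rnorm k * M)%:E)%E.
Proof.
move=> yM; apply: ge_lp_mxnorm => H u x up x1.
have -> : amp_rep u (one (k *: y)) x = fun i => k *: amp_rep u (one y) x i.
  apply/funext => i; rewrite /amp_rep !big_ord1 !mxE.
  rewrite (alg_rep_supp _ _ (msuppZ_le k y)) (alg_rep_supp _ _ (fsubset_refl (msupp y))).
  by rewrite scaler_sumr; apply: eq_bigr => g _; rewrite mcoeffZ scalerA.
by rewrite vnormZ ler_wpM2l ?cnorm_ge0// (vnorm_amp_le up yM).
Qed.

Lemma lp_mxnorm1Z p (k : R) y (M : R) : (2%:E <= p)%E -> (0 < d)%N -> 0 < k ->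
  lp_mxnorm p (one y) = M%:E -> lp_mxnorm p (one (k%:C%C *: y)) = (k * M)%:E.
Proof.
move=> p2 d0 k0 yM; have nk : rnorm (k%:C%C) = k by rewrite cnorm_real gtr0_norm.
apply/eqP; rewrite eq_le; apply/andP; split.
  by rewrite -{2}nk; apply: lp_mxnorm1Z_le; rewrite yM.
have kn0 : k%:C%C != 0 by rewrite eq_complex /= gt_eqF.
have f := lp_mxnorm1_fin_num (k%:C%C *: y) p2 d0.
have : (lp_mxnorm p (one (k%:C%C *: y)) <= (fine (lp_mxnorm p (one (k%:C%C *: y))))%:E)%E.
  by rewrite fineK.
move=> /(lp_mxnorm1Z_le (k%:C%C)^-1).
rewrite scalerA mulVf// scale1r yM lee_fin.
have -> : rnorm (k%:C%C^-1) = k^-1.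
  by rewrite -fmorphV cnorm_real gtr0_norm// invr_gt0.
by rewrite ler_pdivlMl// -lee_fin fineK.
Qed.

Lemma le_cb_norm p q (Y : set A) (phi : A -> A) y (M : R) : Y y ->
  (lp_mxnorm p (one y) <= 1)%E -> lp_mxnorm q (one (phi y)) = M%:E ->
  (M%:E <= cb_norm (@lp_mxnorm R G p) (@lp_mxnorm R G q) Y phi)%E.
Proof.
move=> Yy y1 yM; apply: ereal_sup_ubound; exists 1%N, (one y); split=> //.
  by move=> i j; rewrite mxE.
by rewrite map_const_mx.
Qed.

(** For y in Y of norms M in Y_q and M' after phi in Y_p, normalizing y shows
    that phi has norm at least M'/M, and normalizing its image that psi has norm
    at least M/M'. *)
Lemma d_cb_ge1 p q (Y : set A) : (0 < d)%N -> (2%:E <= p)%E -> (2%:E <= q)%E ->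
  is_subspace Y -> Y <> [set 0] ->
  (1%:E <= d_cb (@lp_mxnorm R G q) (@lp_mxnorm R G p) Y Y)%E.
Proof.
move=> d0 p2 q2 [Y0 Ys] Yn0.
have [y Yy y0] : exists2 y, Y y & y != 0.
  apply: contrapT => h; apply: Yn0; apply/seteqP; split=> [y Yy|_ ->//].
  by apply/eqP/negPn/negP => y0; apply: h; exists y.
apply: le_ereal_inf_tmp => _ [phi [psi [[lin phiY psiY K K'] ->]]].
have phi0 : phi 0 = 0.
  have := lin 1 0 0 Y0 Y0; rewrite !scale1r addr0 => h.
  by apply: (addrI (phi 0)); rewrite addr0 -h.
have phiZ (k : R[i]) : phi (k *: y) = k *: phi y.
  by have := lin k y 0 Yy Y0; rewrite !addr0 phi0 addr0.
have YZ (k : R[i]) x : Y x -> Y (k *: x).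
  by move=> Yx; have := Ys k x 0 Yx Y0; rewrite addr0.
have z0 : phi y != 0.
  by apply: contra_neq y0 => phiy; rewrite -(K _ Yy) phiy -phi0 K.
have [M M0 yM] := lp_mxnorm1_gt0 q2 d0 y0.
have [M' M'0 zM] := lp_mxnorm1_gt0 p2 d0 z0.
have iM0 : 0 < M^-1 by rewrite invr_gt0.
have iM'0 : 0 < M'^-1 by rewrite invr_gt0.
have := @le_cb_norm q p Y phi (M^-1%:C%C *: y) (M^-1 * M') (YZ _ _ Yy).
rewrite phiZ (lp_mxnorm1Z q2 d0 iM0 yM) (lp_mxnorm1Z p2 d0 iM0 zM).
rewrite mulVf ?gt_eqF// lexx => /(_ isT erefl) h1.
have := @le_cb_norm p q Y psi (M'^-1%:C%C *: phi y) (M'^-1 * M) (YZ _ _ (phiY _ Yy)).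
rewrite (lp_mxnorm1Z p2 d0 iM'0 zM) -phiZ (K _ (YZ _ _ Yy)).
rewrite (lp_mxnorm1Z q2 d0 iM'0 yM) mulVf ?gt_eqF// lexx => /(_ isT erefl) h2.
have h3 : (0 <= (M^-1 * M')%:E)%E by rewrite lee_fin mulr_ge0 ?ltW.
have h4 : (0 <= (M'^-1 * M)%:E)%E by rewrite lee_fin mulr_ge0 ?ltW.
apply: le_trans (lee_pmul h3 h4 h1 h2).
rewrite -EFinM lee_fin (_ : _ * _ = 1)//; field.
by rewrite !gt_eqF.
Qed.

(** The empty matrix is always in the unit ball. *)
Lemma cb_id_ge0 p q (Y : set A) : (0 < d)%N -> (2%:E <= q)%E ->
  (0 <= cb_norm (@lp_mxnorm R G p) (@lp_mxnorm R G q) Y id)%E.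
Proof.
move=> d0 q2; pose a : 'M[A]_0 := const_mx 0.
apply: (@le_trans _ _ (lp_mxnorm q (map_mx id a))); first exact: lp_mxnorm_ge0.
apply: ereal_sup_ubound; exists 0%N, a; split=> //; first by move=> [].
by apply: ge_lp_mxnorm => H u x _ _; rewrite /vnorm big_ord0 sqrtr0.
Qed.

Lemma supported_fd (Y : set A) : finite_dimensional Y ->
  exists S : {fset G}, forall y, Y y -> (msupp y `<=` S)%fset.
Proof.
move=> [n [b ->]]; exists (\big[fsetU/fset0]_i msupp (b i))%fset => y [c ->].
apply/fsubsetP => g; rewrite -mcoeff_neq0; apply: contraNT => gS.
rewrite raddf_sum big1// => i _ /=; rewrite mcoeffZ mcoeff_outdom ?mulr0//.
by apply: contra gS; apply/fsubsetP; rewrite (bigD1 i)//= fsubsetUl.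
Qed.

Lemma cb_id_le1 p q (Y : set A) : (2%:E <= p)%E -> (p <= q)%E ->
  (cb_norm (@lp_mxnorm R G q) (@lp_mxnorm R G p) Y id <= 1)%E.
Proof.
move=> p2 pq; apply: ge_ereal_sup => _ [n [a [aY a1 ->]]].
by rewrite map_mx_id//; apply: le_trans a1; exact: lp_mxnorm_mono.
Qed.

Lemma cb_id_le p q (N : nat) (r : R) (S : {fset G}) (Y : set A) :
  (0 < d)%N -> (2%:E <= p)%E -> close_exponents p q N -> 0 < r < 1 ->
  (d * 2)%:R * r ^+ N <= 2^-1 -> (forall y, Y y -> (msupp y `<=` S)%fset) ->
  (cb_norm (@lp_mxnorm R G p) (@lp_mxnorm R G q) Y id <=
    (1 + \sum_(g <- S) (1 - r ^+ size g))%:E)%E.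
Proof.
move=> d0 p2 pq r01 dN YS; apply: ge_ereal_sup => _ [n [a [aY a1 ->]]].
rewrite map_mx_id//; apply: ge_lp_mxnorm => H u x uq x1.
apply: (contraction_bound p2 d0 pq r01 dN uq) => // i j.
exact: YS.
Qed.

Lemma close_exponents_le p q N : close_exponents p q N -> (p <= q)%E.
Proof. by case: p => [s| |]; case: q => [t| |]//=; rewrite ?leey// lee_fin => -[]. Qed.

Lemma linear_iso_id (Y : set A) : linear_iso Y Y id id.
Proof. by split. Qed.

(** The identity is the isomorphism: one of its two cb-norms is at most 1 by
    monotonicity of the norms in the exponent. *)
Lemma d_cb_le p q (N : nat) (r : R) (S : {fset G}) (Y : set A) :
  (0 < d)%N -> (2%:E <= p)%E -> (2%:E <= q)%E ->
  close_exponents p q N \/ close_exponents q p N -> 0 < r < 1 ->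
  (d * 2)%:R * r ^+ N <= 2^-1 -> (forall y, Y y -> (msupp y `<=` S)%fset) ->
  (d_cb (@lp_mxnorm R G q) (@lp_mxnorm R G p) Y Y <=
    (1 + \sum_(g <- S) (1 - r ^+ size g))%:E)%E.
Proof.
move=> d0 p2 q2 pq r01 dN YS.
apply: (@le_trans _ _ (cb_norm (@lp_mxnorm R G q) (@lp_mxnorm R G p) Y id *
                       cb_norm (@lp_mxnorm R G p) (@lp_mxnorm R G q) Y id)%E).
  by apply: ereal_inf_lbound; exists id, id; split=> //; exact: linear_iso_id.
case: pq => pq.
  rewrite -[leRHS]mul1e; apply: lee_pmul; rewrite ?cb_id_ge0//.
    exact: cb_id_le1 (close_exponents_le pq).
  exact: (cb_id_le d0 p2 pq r01 dN YS).
rewrite -[leRHS]mule1; apply: lee_pmul; rewrite ?cb_id_ge0//.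
  exact: (cb_id_le d0 q2 pq r01 dN YS).
exact: cb_id_le1 (close_exponents_le pq).
Qed.

End Scalars.

(** * The limit *)

Lemma bernoulli_le (R : realType) (r : R) k : 0 <= r -> r <= 1 ->
  1 - r ^+ k <= k%:R * (1 - r).
Proof.
move=> r0 r1; elim: k => [|k IH]; first by rewrite expr0 subrr mul0r.
have rk1 : r ^+ k <= 1 by rewrite exprn_ile1.
have rk0 : 0 <= r ^+ k by rewrite exprn_ge0.
rewrite exprS -natr1 mulrDl mul1r.
have : r ^+ k * (1 - r) <= 1 - r by rewrite ler_piMl// subr_ge0.
by move: IH => *; lra.
Qed.

Lemma exists_radius (R : realType) (d : nat) (S : {fset free_group d}) (e : R) :
  0 < e -> exists2 r : R, 0 < r < 1 & \sum_(g <- S) (1 - r ^+ size g) <= e.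
Proof.
move=> e0; pose L : R := (\sum_(g <- S) size g)%N.+1%:R.
have L1 : 1 <= L by rewrite ler1n.
have L0 : 0 < L by apply: lt_le_trans L1.
pose x := Num.min (2^-1) (e / L).
have x0 : 0 < x by rewrite lt_min invr_gt0 ltr0n divr_gt0.
have x1 : x <= 2^-1 by rewrite ge_min lexx.
have xe : x * L <= e by rewrite -ler_pdivlMr// ge_min lexx orbT.
exists (1 - x); first by apply/andP; split; lra.
apply: le_trans xe; apply: (@le_trans _ _ (\sum_(g <- S) x * (size g)%:R)).
  apply: ler_sum => g _; have r0 : 0 <= 1 - x by lra.
  have r1 : 1 - x <= 1 by lra.
  by have := bernoulli_le (size g) r0 r1; rewrite (_ : 1 - (1 - x) = x) 1?mulrC//; ring.
by rewrite -mulr_sumr -natr_sum ler_pM2l// ler_nat.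
Qed.

Lemma exists_power (R : realType) (d : nat) (r : R) : 0 < r < 1 ->
  exists N : nat, (d * 2)%:R * r ^+ N <= 2^-1.
Proof.
move=> /andP[r0 r1].
have nr : `|r| < 1 by rewrite gtr0_norm.
have e0 : 0 < 2^-1 / (d * 2).+1%:R :> R by rewrite divr_gt0.
have /cvgrPdist_lt/(_ _ e0)[N _ /(_ N (leqnn N))] := cvg_expr nr.
rewrite /= sub0r normrN gtr0_norm ?exprn_gt0// => h; exists N.
rewrite ltr_pdivlMr// in h; apply: le_trans (ltW h); rewrite mulrC.
by rewrite ler_pM2l ?exprn_gt0// ler_nat.
Qed.

(** For finite exponents s, t >= 2 one has s t >= 4, so |t - s| < 4/(N+1) is
    enough; at infinity q >= N is enough. *)
Lemma close_near (R : realType) (p : \bar R) (N : nat) : (2%:E <= p)%E ->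
  \forall q \near p, (2%:E <= q)%E -> close_exponents p q N \/ close_exponents q p N.
Proof.
case: p => [s| |]// s2; last first.
  exists (N%:R); split; first exact: num_real.
  move=> [t| |] //; last by left.
  by rewrite lte_fin => Nt _; right; exact: ltW.
rewrite lee_fin in s2.
have e0 : 0 < 4 / N.+1%:R :> R by rewrite divr_gt0.
exists (4 / N.+1%:R) => //= t; rewrite /ball /= => st; rewrite lee_fin => t2.
have H (x y : R) : 2 <= x -> 2 <= y -> y - x < 4 / N.+1%:R -> x <= y -> close_exponents x%:E y%:E N.
  move=> x2 y2; rewrite ltr_pdivlMr// => yx xy; split=> //.
  have : (y - x) * N%:R <= (y - x) * N.+1%:R by rewrite ler_wpM2l ?subr_ge0// ler_nat.
  have : 2 * 2 <= x * y by apply: ler_pM.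
  by move: yx; lra.
have /orP[le_st|le_ts] := le_total s t.
  left; apply: (H s t) => //; apply: le_lt_trans st.
  by rewrite distrC ler_norm.
right; apply: (H t s) => //.
by apply: le_lt_trans st; exact: ler_norm.
Qed.

Unset Implicit Arguments.
Set Strict Implicit.
Set Printing Implicit Defensive.

Theorem corollary3p11 (R : realType) (d : nat) (d_ge2 : (2 <= d)%N)
    (Y : set (group_algebra R (free_group d)))
    (Y_sub : is_subspace Y) (Y_fin : finite_dimensional Y)
    (Y_neq0 : Y <> [set 0])
    (p : \bar R) (p_ge2 : (2%:E <= p)%E) :
  d_cb (@lp_mxnorm R (free_group d) q) (@lp_mxnorm R (free_group d) p) Y Y
    @[q --> within [set q : \bar R | (2%:E <= q)%E] p^'] --> 1%E.
Proof.
have d0 : (0 < d)%N by apply: leq_trans d_ge2.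
have [S YS] := supported_fd Y_fin.
move=> A /= -[e /= e0 eA].
(* First r is chosen from the precision e and the support S of Y, and only then
   N, hence the neighbourhood of p, from r. *)
have [r r01 rS] := exists_radius S (divr_gt0 e0 (ltr0n _ 2)).
have [N dN] := exists_power d r01.
suff near_p : \forall q \near p, (2%:E <= q)%E ->
    A (d_cb (@lp_mxnorm R (free_group d) q) (@lp_mxnorm R (free_group d) p) Y Y).
  by rewrite /= /within /=; apply: nbhs_dnbhs.
apply: filterS (close_near N p_ge2) => q pq q2.
have lo := @d_cb_ge1 R d p q Y d0 p_ge2 q2 Y_sub Y_neq0.
have hi := d_cb_le d0 p_ge2 q2 (pq q2) r01 dN YS.
move: (d_cb _ _ _ _) lo hi => [x| |]//=; rewrite !lee_fin => lo hi.
apply: eA; rewrite /ball /= distrC ger0_norm ?subr_ge0//.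
have : e / 2 < e by rewrite gtr_pMr// invf_lt1// ltr1n.
by move: hi rS; lra.
Qed.
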